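(* Let $K$ be a number field with ring of integers $\mathcal{O}$, and let $Q_{1,1}$ be the unipotent group scheme over $\mathbb{Z}$ defined in the context (case $m=n=1$). For every non-zero prime ideal $\mathfrak{p}$ of $\mathcal{O}$, let $\mathcal{O}_{\mathfrak p}$ be the completion of $\mathcal{O}$ at $\mathfrak p$, let $q=|\mathcal{O}/\mathfrak{p}|$ and write $t=q^{-s}$. Then $$\zeta_{Q_{1,1}(\mathcal{O}_{\mathfrak p})}(s)=\frac{(1-t)(1-q^{2}t)}{(1-q^{3}t)(1-q^{4}t)}.$$
   Context: **Representation zeta function.** For a pro-$p$ group $G=Q_{m,n}(\mathcal{O}_{\mathfrak p})$ as below, two continuous irreducible finite-dimensional complex representations $\rho,\sigma$ of $G$ are twist-equivalent if $\sigma\cong\rho\otimes\chi$ for some continuous one-dimensional representation $\chi$ of $G$. The equivalence classes are called twist-isoclasses. Let $\widetilde r_k(G)$ be the number of twist-isoclasses of continuous irreducible complex representations of $G$ of dimension $k$. The zeta function of $G$ is $\zeta_G(s)=\sum_{k\ge1}\widetilde r_k(G)k^{-s}$, with $s$ a complex variable. It converges for $\mathrm{Re}(s)$ sufficiently large, and the identity is one of Dirichlet series there, hence of meromorphic functions. **The group schemes $Q_{m,n}$.** Let $m\ge n\ge1$. Let $\mathbf{Y}_0=(Y_{11},\dots,Y_{2m,2n})$ be variables, $(Y_{ij})$ the generic $2m\times2n$ matrix in these variables, and $Y$ a further variable; put $\mathbf{Y}=(Y,\mathbf{Y}_0)$. Let $J_m\in\mathrm{Mat}_{2m}(\mathbb{Z})$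 be the matrix $(a_{ij})$ with $a_{2i-1,2i}=1$ and $a_{2i,2i-1}=-1$ for $1\le i\le m$, all other entries zero. Define the antisymmetric matrix $$\mathcal{R}(\mathbf{Y})=\begin{pmatrix}YJ_m&(Y_{ij})\\-(Y_{ij})^{\mathrm t}&0\end{pmatrix}\in\mathrm{Mat}_{2(m+n)}(\mathbb{Z}[\mathbf{Y}]).$$ Let $\mathcal{Q}_{m,n}$ be the nilpotent $\mathbb{Z}$-Lie lattice of class $2$, free as a $\mathbb{Z}$-module on generators $x_r$ ($1\le r\le2(m+n)$), $y_{ij}$ ($1\le i\le2m$, $1\le j\le2n$) and $y$, with $y$ and all $y_{ij}$ central and $[x_a,x_b]=\mathcal{R}(\mathbf{y})_{a,b}$ for $1\le a,b\le2(m+n)$, where $\mathcal{R}(\mathbf{y})$ is obtained by substituting $Y\mapsto y$, $Y_{ij}\mapsto y_{ij}$. Let $Z$ be the $\mathbb{Z}$-span of $y$ and the $y_{ij}$. Then $Q_{m,n}$ is the associated class-$2$ unipotent group scheme over $\mathbb{Z}$: for a commutative ring $R$, $Q_{m,n}(R)$ is the set $R^{2(m+n)}\times(Z\otimes R)$ with multiplication $$(u,z)(u',z')=\Big(u+u',\,z+z'+\sum_{a<b}u_au'_b\,[x_a,x_b]\Big).$$ The commutator of $(u,z)$ and $(u',z')$ is then $(0,[\sum_a u_ax_a,\sum_b u'_bx_b])$. If $2$ is invertible in $R$, this group is isomorphic to the group on $\mathcal{Q}_{m,n}\otimes R$ with Hausdorff multiplication $v*w=v+w+\frac12[v,w]$.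 The group $Q_{m,n}(\mathcal{O}_{\mathfrak p})$ carries its $\mathfrak p$-adic (pro-$p$) topology. *)

(* Defs.v *)
From HB Require Import structures.
From mathcomp Require Import all_boot all_order all_algebra all_field.
From mathcomp Require Import finmap ring_quotient complex.
From mathcomp Require Import all_classical all_reals all_analysis.
Import numFieldNormedType.Exports.
Import Order.TTheory GRing.Theory Num.Theory.

Set Implicit Arguments.
Unset Strict Implicit.
Unset Printing Implicit Defensive.

Local Open Scope classical_set_scope.
Local Open Scope quotient_scope.
Local Open Scope ring_scope.

Section RingOfIntegers.
Variable K : fieldExtType rat.

Definition integral_pred : {pred K} :=
  fun x => `[< integralOver (intr : int -> K) x >].

Fact integral_subring : subring_closed integral_pred.
Proof.
split=> [|x y|x y]; rewrite !unfold_in.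
- by apply/asboolP; apply: integral1.
- by move=> /asboolP ix /asboolP iy; apply/asboolP; apply: integral_sub.
- by move=> /asboolP ix /asboolP iy; apply/asboolP; apply: integral_mul.
Qed.

HB.instance Definition _ :=
  GRing.isSubringClosed.Build K integral_pred integral_subring.

Record ring_of_integers := RingOfIntegers {
  int_val :> K;
  int_valP : int_val \in integral_pred
}.

HB.instance Definition _ := [isSub for int_val].
HB.instance Definition _ := [Choice of ring_of_integers by <:].
HB.instance Definition _ := [SubChoice_isSubComNzRing of ring_of_integers by <:].

End RingOfIntegers.

(* The completion of a commutative ring A at a proper ideal I, as the inverse
   limit of the A / I^(k+1), k >= 0. *)
Section Completion.
Variables (A : comNzRingType) (I : idealr A).

(* I^k: finite sums of products of an element of I and one of I^(k-1). *)
Fixpoint ideal_exp (k : nat) : set A :=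
  if k is l.+1 then
    [set x | exists2 s : seq (A * A),
       (forall ab, ab \in s -> ab.1 \in I /\ ideal_exp l ab.2) &
       x = \sum_(ab <- s) ab.1 * ab.2]
  else setT.

Definition ideal_expS (k : nat) : {pred A} := fun x => `[< ideal_exp k.+1 x >].

Lemma ideal_expD k x y : ideal_exp k x -> ideal_exp k y -> ideal_exp k (x + y).
Proof.
case: k => [|k] //= [s sI ->] [t tI ->]; exists (s ++ t); last by rewrite big_cat.
by move=> ab; rewrite mem_cat => /orP[/sI|/tI].
Qed.

Lemma ideal_exp0 k : ideal_exp k 0.
Proof. by case: k => [|k] //=; exists [::]; rewrite ?big_nil. Qed.

Lemma ideal_expM k a x : ideal_exp k x -> ideal_exp k (a * x).
Proof.
case: k => [|k] //= [s sI ->].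
exists [seq (a * ab.1, ab.2) | ab <- s].
  by move=> _ /mapP[ab /sI[abI ?] ->] /=; split=> //; apply: idealMr.
by rewrite big_map mulr_sumr; apply: eq_bigr => ab _ /=; rewrite mulrA.
Qed.

Lemma ideal_expW k x : ideal_exp k.+1 x -> ideal_exp k x.
Proof.
elim: k x => [|k IH] x //= [s sI ->]; exists s => // ab /sI[abI /IH]; by split.
Qed.

Lemma ideal_expS_idealr k : idealr_closed (ideal_expS k).
Proof.
split; first by apply/asboolP; apply: ideal_exp0.
- apply/asboolP => -[s sI s1]; have := idealr1 I; rewrite s1 => /negP; apply.
  rewrite big_seq; apply: rpred_sum => ab /sI[abI _].
  by rewrite mulrC idealMr.
- move=> a x y /asboolP xI /asboolP yI; apply/asboolP.
  by apply: ideal_expD => //; apply: ideal_expM.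
Qed.

HB.instance Definition _ k :=
  isIdealr.Build A (ideal_expS k) (ideal_expS_idealr k).

Local Notation quo k := {ideal_quot (ideal_expS k)}.

Record completion := Completion {
  cproj : forall k, quo k;
  cprojP : forall k, cproj k = \pi_(quo k) (repr (cproj k.+1))
}.

Lemma completionP (x y : completion) : (forall k, cproj x k = cproj y k) -> x = y.
Proof.
case: x y => [x xP] [y yP] /= xy; have {}xy : x = y by apply: functional_extensionality_dep.
by rewrite xy in xP *; congr Completion; apply: Prop_irrelevance.
Qed.

HB.instance Definition _ := gen_eqMixin completion.
HB.instance Definition _ := gen_choiceMixin completion.

Lemma pi_expS k x y :
  x = y %[mod quo k.+1] -> x = y %[mod quo k].
Proof.
move=> /eqP; rewrite -Quotient.idealrBE => /asboolP /ideal_expW xy.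
by apply/eqP; rewrite -Quotient.idealrBE; apply/asboolP.
Qed.

Fact completion_of_subproof a k :
  \pi_(quo k) a = \pi_(quo k) (repr (\pi_(quo k.+1) a)).
Proof. by apply: pi_expS; rewrite reprK. Qed.
Definition completion_of a := Completion (completion_of_subproof a).

Fact completion_add_subproof x y k :
  cproj x k + cproj y k = \pi_(quo k) (repr (cproj x k.+1 + cproj y k.+1)).
Proof.
rewrite (cprojP x) (cprojP y) -rmorphD; apply: pi_expS.
by rewrite rmorphD !reprK; congr (_ + _); apply: reprK.
Qed.
Definition completion_add x y := Completion (completion_add_subproof x y).

Fact completion_opp_subproof x k :
  - cproj x k = \pi_(quo k) (repr (- cproj x k.+1)).
Proof.
rewrite (cprojP x) -rmorphN; apply: pi_expS.
by rewrite rmorphN !reprK; congr (- _); apply: reprK.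
Qed.
Definition completion_opp x := Completion (completion_opp_subproof x).

Fact completion_mul_subproof x y k :
  cproj x k * cproj y k = \pi_(quo k) (repr (cproj x k.+1 * cproj y k.+1)).
Proof.
rewrite (cprojP x) (cprojP y) -rmorphM; apply: pi_expS.
by rewrite rmorphM !reprK; congr (_ * _); apply: reprK.
Qed.
Definition completion_mul x y := Completion (completion_mul_subproof x y).

Fact completion_addA : associative completion_add.
Proof. by move=> x y z; apply: completionP => k /=; rewrite addrA. Qed.
Fact completion_addC : commutative completion_add.
Proof. by move=> x y; apply: completionP => k /=; rewrite addrC. Qed.
Fact completion_add0 : left_id (completion_of 0) completion_add.
Proof. by move=> x; apply: completionP => k /=; rewrite rmorph0 add0r. Qed.
Fact completion_addN :
  left_inverse (completion_of 0) completion_opp completion_add.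
Proof. by move=> x; apply: completionP => k /=; rewrite rmorph0 addNr. Qed.

HB.instance Definition _ := GRing.isZmodule.Build completion
  completion_addA completion_addC completion_add0 completion_addN.

Fact completion_mulA : associative completion_mul.
Proof. by move=> x y z; apply: completionP => k /=; rewrite mulrA. Qed.
Fact completion_mulC : commutative completion_mul.
Proof. by move=> x y; apply: completionP => k /=; rewrite mulrC. Qed.
Fact completion_mul1 : left_id (completion_of 1) completion_mul.
Proof. by move=> x; apply: completionP => k /=; rewrite rmorph1 mul1r. Qed.
Fact completion_mulDl : left_distributive completion_mul +%R.
Proof. by move=> x y z; apply: completionP => k /=; rewrite mulrDl. Qed.
Fact completion_1_neq0 : completion_of 1 != 0.
Proof.
apply/eqP => /(congr1 (fun x => cproj x 0)) /= /eqP.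
by rewrite rmorph1 rmorph0 oner_eq0.
Qed.

HB.instance Definition _ := GRing.Zmodule_isComNzRing.Build completion
  completion_mulA completion_mulC completion_mul1 completion_mulDl
  completion_1_neq0.

(* The I-adic topology: the kernels of the projections to the A / I^(k+1)
   form a base of neighbourhoods of 0. *)
Definition completion_nbhs (x : completion) : set_system completion :=
  filter_from setT (fun k => [set y | cproj y k = cproj x k]).

HB.instance Definition _ := hasNbhs.Build completion completion_nbhs.

Lemma cproj_le (x y : completion) (j k : nat) :
  (j <= k)%N -> cproj x k = cproj y k -> cproj x j = cproj y j.
Proof.
move=> /subnK <-; elim: (k - j)%N => [|i IH] //=.
by rewrite addSn => xy; apply: IH; rewrite cprojP xy -cprojP.
Qed.

Fact completion_nbhs_filter (x : completion) : ProperFilter (nbhs x).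
Proof.
apply: filter_from_proper => [|k _]; last by exists x.
apply: filter_from_filter => [|i j _ _]; first by exists 0%N.
exists (maxn i j) => // y /= yx.
by split; apply: (@cproj_le _ _ _ (maxn i j)); rewrite ?leq_maxl ?leq_maxr.
Qed.

Fact completion_nbhs_singleton (x : completion) (B : set completion) :
  nbhs x B -> B x.
Proof. by move=> [k _]; apply. Qed.

Fact completion_nbhs_nbhs (x : completion) (B : set completion) :
  nbhs x B -> nbhs x (nbhs^~ B).
Proof.
move=> [k _ kB]; exists k => // y /= yx; exists k => // z /= zy.
by apply: kB; rewrite /= zy.
Qed.

HB.instance Definition _ := Nbhs_isNbhsTopological.Build completion
  completion_nbhs_filter completion_nbhs_singleton completion_nbhs_nbhs.

End Completion.

Section Q.
Variables m n : nat.

(* J_m with indices starting at 0. *)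
Definition J_mx : 'M[int]_(2 * m) := \matrix_(i, j)
  if ~~ odd i && (j == i.+1 :> nat) then 1
  else if odd i && (i == j.+1 :> nat) then -1 else 0.

(* The commutator matrix R(Y), with entries in an arbitrary abelian group in
   which values for the variables Y and Y_ij are given. *)
Definition commutator_mx (V : zmodType) (y : V) (Y : 'M[V]_(2 * m, 2 * n)) :
    'M[V]_(2 * m + 2 * n) :=
  block_mx (map_mx (fun c => y *~ c) J_mx) Y (- Y^T) 0.

Variable R : comPzRingType.

(* Z tensor R, in the coordinates of the basis y, (y_ij). *)
Definition Zspan : Type := (R^o * 'M[R]_(2 * m, 2 * n))%type.
HB.instance Definition _ := GRing.Lmodule.on Zspan.

Definition Zy : Zspan := (1, 0).
Definition Zyij (i : 'I_(2 * m)) (j : 'I_(2 * n)) : Zspan := (0, delta_mx i j).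

Definition bracket_x (a b : 'I_(2 * m + 2 * n)) : Zspan :=
  commutator_mx Zy (\matrix_(i, j) Zyij i j) a b.

Definition Qgroup : Type := ('rV[R]_(2 * m + 2 * n) * Zspan)%type.
HB.instance Definition _ := Choice.on Qgroup.

Definition Qcocycle (u v : 'rV[R]_(2 * m + 2 * n)) : Zspan :=
  \sum_(a < 2 * m + 2 * n) \sum_(b < 2 * m + 2 * n | (a < b)%N)
    (u 0 a * v 0 b) *: bracket_x a b.

Definition Qmul (g h : Qgroup) : Qgroup :=
  (g.1 + h.1, g.2 + h.2 + Qcocycle g.1 h.1).
Definition Qone : Qgroup := (0, 0).
Definition Qinv (g : Qgroup) : Qgroup := (- g.1, - g.2 + Qcocycle g.1 g.1).

Lemma QcocycleDl u u' v : Qcocycle (u + u') v = Qcocycle u v + Qcocycle u' v.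
Proof.
rewrite -big_split; apply: eq_bigr => a _; rewrite -big_split.
by apply: eq_bigr => b _; rewrite mxE mulrDl scalerDl.
Qed.

Lemma QcocycleDr u v v' : Qcocycle u (v + v') = Qcocycle u v + Qcocycle u v'.
Proof.
rewrite -big_split; apply: eq_bigr => a _; rewrite -big_split.
by apply: eq_bigr => b _; rewrite mxE mulrDr scalerDl.
Qed.

Lemma Qcocycle0l v : Qcocycle 0 v = 0.
Proof. by apply: (addrI (Qcocycle 0 v)); rewrite -QcocycleDl !addr0. Qed.

Lemma Qcocycle0r u : Qcocycle u 0 = 0.
Proof. by apply: (addrI (Qcocycle u 0)); rewrite -QcocycleDr !addr0. Qed.

Lemma QcocycleNl u v : Qcocycle (- u) v = - Qcocycle u v.
Proof.
by apply: (addrI (Qcocycle u v)); rewrite -QcocycleDl !subrr Qcocycle0l.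
Qed.

Lemma QcocycleNr u v : Qcocycle u (- v) = - Qcocycle u v.
Proof.
by apply: (addrI (Qcocycle u v)); rewrite -QcocycleDr !subrr Qcocycle0r.
Qed.

Fact QmulA : associative Qmul.
Proof.
move=> g h k; congr pair; first by rewrite addrA.
rewrite /= QcocycleDl QcocycleDr !addrA.
rewrite [in RHS](addrAC _ (Qcocycle g.1 h.1) k.2) -!addrA.
by do 3!congr (_ + _); rewrite addrC addrA.
Qed.
Fact Qmul1g : left_id Qone Qmul.
Proof. by move=> [u z]; rewrite /Qmul /= !add0r Qcocycle0l addr0. Qed.
Fact Qmulg1 : right_id Qone Qmul.
Proof. by move=> [u z]; rewrite /Qmul /= !addr0 Qcocycle0r addr0. Qed.
Fact QmulVg : left_inverse Qone Qinv Qmul.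
Proof.
move=> [u z]; rewrite /Qmul /Qinv /= QcocycleNl addNr.
by rewrite (addrAC (- z)) addNr add0r subrr.
Qed.
Fact QmulgV : right_inverse Qone Qinv Qmul.
Proof.
by move=> [u z]; rewrite /Qmul /Qinv /= QcocycleNr subrr addrA subrr add0r subrr.
Qed.

HB.instance Definition _ := isGroup.Build Qgroup QmulA Qmul1g Qmulg1 QmulVg QmulgV.

End Q.

(* Only juxtaposes the two structures: no continuity of the group operations is
   asked for. *)
#[short(type="preTopologicalGroupType")]
HB.structure Definition PreTopologicalGroup := {G of Group G & Topological G}.

HB.instance Definition _ (A : comNzRingType) (I : idealr A) m n :=
  Topological.copy (Qgroup m n (completion I))
    ('rV[completion I]_(2 * m + 2 * n) *
     (completion I * 'M[completion I]_(2 * m, 2 * n)))%type.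

Definition Cplx (R : realType) : numClosedFieldType := R[i].

Section Representations.
Variables (R : realType) (G : preTopologicalGroupType).
Local Notation C := (Cplx R).

Definition cont_repr d (rho : G -> 'M[C]_d) : Prop :=
  [/\ rho 1%g = 1%:M, forall g h, rho (g * h)%g = rho g *m rho h & continuous rho].

Definition irr_repr d (rho : G -> 'M[C]_d) : Prop :=
  (0 < d)%N /\
  forall U : {vspace 'cV[C]_d},
    (forall g v, v \in U -> rho g *m v \in U) -> U = 0%VS \/ U = fullv.

Definition repr_iso d (sigma rho : G -> 'M[C]_d) : Prop :=
  exists2 B, B \in unitmx & forall g, sigma g = B *m rho g *m invmx B.

(* rho (x) chi, for a one-dimensional chi. *)
Definition repr_twist d (rho : G -> 'M[C]_d) (chi : G -> 'M[C]_1) : G -> 'M[C]_d :=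
  fun g => chi g 0 0 *: rho g.

Definition twist_equiv d (rho sigma : G -> 'M[C]_d) : Prop :=
  exists2 chi, cont_repr chi & repr_iso sigma (repr_twist rho chi).

Definition cont_irr d : set (G -> 'M[C]_d) :=
  [set rho | cont_repr rho /\ irr_repr rho].

Definition twist_isoclass d (rho : G -> 'M[C]_d) : set (G -> 'M[C]_d) :=
  [set sigma | @cont_irr d sigma /\ twist_equiv rho sigma].

Definition twist_isoclasses d : set (set (G -> 'M[C]_d)) :=
  [set twist_isoclass rho | rho in @cont_irr d].

(* x ^ s = exp (s ln x) for x > 0 real and s complex. *)
Definition cpow (x : R) (s : C) : C :=
  let r := expR (complex.Re s * ln x) in
  let theta := complex.Im s * ln x in
  ((r * cos theta) +i* (r * sin theta))%C.

(* The number of elements of a finite set; 0 by convention if it is infinite. *)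
Definition ncard (T : choiceType) (A : set T) : nat := #|` fset_set A|%fset.

Definition zeta_partial (s : C) (N : nat) : C :=
  \sum_(1 <= k < N) (ncard (@twist_isoclasses k))%:R * cpow k%:R (- s).

Definition zeta (s : C) : C := limn (zeta_partial s).

End Representations.

Arguments cont_irr : clear implicits.
Arguments twist_isoclasses : clear implicits.

(* Main.v *)
Require Import Defs.
From HB Require Import structures.
From mathcomp Require Import all_boot all_order all_algebra all_field.
From mathcomp Require Import finmap ring_quotient complex.
From mathcomp Require Import all_classical all_reals all_analysis.
From mathcomp Require Import ring zify lra.
Import numFieldNormedType.Exports.
Import Order.TTheory GRing.Theory Num.Theory.

(** Let q be the residue cardinality.  An irreducible representation of the class-2
    group G has a central character psi, which is trivial modulo some power of p.
    Two representations with the same psi differ by a twist: the operators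
    X |-> rho g X sigma g^-1 commute, and a common eigenvector intertwines rho with
    a twist of sigma.  Conversely a twist does not change psi, the centre being the
    derived subgroup.  So twist classes correspond to the psi, i.e. to pairs (a, A)
    over B = O / p^e with A a 2 x 2 matrix, and the dimension d satisfies
    d^2 |ker R(a, A)| = |B|^4.  Diagonalising A one finds that d is a power of q,
    and that d <= q^e exactly when psi has level at most e and det A = 0 in B.
    Hence the number of classes of dimension at most q^e is q^e times the number of
    singular 2 x 2 matrices over B, i.e. ((q + 1) q^(4e) - q^(3e)) / q, and the zeta
    function is a sum of two geometric series. *)

Set Implicit Arguments.
Unset Strict Implicit.
Unset Printing Implicit Defensive.

Local Open Scope ring_scope.

(** * Irreducible families of matrices *)

Section MatrixFamilies.
Variable C : closedFieldType.

(** Kirillov's orbit method divides by 2; central characters and Schur's lemma treat all residue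
    characteristics alike. If A is diagonalised with valuations k, l and a has valuation h, all
    capped at e, then |ker R(a, A)| = q^(2i) with i = min(k + l, e + h), so d = q^(2e - i). Thus d
    <= q^e means k + l >= e, with no condition on a, while i > e puts a and A into the maximal ideal
    and lowers the level of psi. This is why classes are counted cumulatively: a single dimension
    would need the joint distribution of the valuations, whereas singular matrices are easy to
    count, and Abel summation turns the cumulative counts into the zeta function. The arithmetic
    input is that O / p^e is a finite chain ring. It is obtained without factorization of ideals,
    from finiteness modulo a prime number l in p and an element generating p up to a factor outside
    p. Continuity enters through the absence of small subgroups in the non-zero complex numbers,
    which makes psi and rho factor through a finite level. *)

Definition irr_family (I : Type) d (rho : I -> 'M[C]_d) : Prop :=
  (0 < d)%N /\
  forall U : {vspace 'cV[C]_d},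
    (forall i v, v \in U -> rho i *m v \in U) -> U = 0%VS \/ U = fullv.

Lemma linv_exists n m (P : 'M[C]_(n, m)) :
  (forall c : 'cV_m, P *m c = 0 -> c = 0) -> exists P', P' *m P = 1%:M.
Proof.
move=> Pinj; have : row_free P^T.
  rewrite -kermx_eq0; apply/eqP/row_matrixP => i; rewrite row0.
  have /(congr1 trmx) : row i (kermx P^T) *m P^T = 0.
    by rewrite -row_mul mulmx_ker row0.
  rewrite trmx_mul trmxK trmx0 => /Pinj /(congr1 trmx).
  by rewrite trmxK trmx0.
move=> /row_freeP[B PB]; exists B^T.
by rewrite -[P]trmxK -trmx_mul PB trmx1.
Qed.

Lemma rinv_exists n m (P : 'M[C]_(n, m)) :
  (forall v : 'cV_n, exists c : 'cV_m, v = P *m c) -> exists P', P *m P' = 1%:M.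
Proof.
move=> Psurj.
have Pc j : exists c : 'cV_m, delta_mx j 0 == P *m c.
  by have [c ->] := Psurj (delta_mx j 0); exists c.
exists (\matrix_(i, j) (xchoose (Pc j)) i 0).
apply/matrixP => i j.
rewrite !mxE; have /eqP/colP/(_ i) := xchooseP (Pc j); rewrite !mxE eqxx andbT.
by rewrite eq_sym => -> ; apply: eq_bigr => k _; rewrite mxE.
Qed.

(** Subspaces are replaced by a basis matrix with a left inverse, so that restricting an operator
    becomes matrix multiplication. *)
Lemma vspace_mx n (U : {vspace 'cV[C]_n}) : exists P : 'M[C]_(n, \dim U),
  [/\ forall c, P *m c \in U, exists P', P' *m P = 1%:M &
      forall v, v \in U -> exists c, v = P *m c].
Proof.
pose P := \matrix_(i < n, j < \dim U) (vbasis U)`_j i 0.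
have PE c : P *m c = \sum_j c j 0 *: (vbasis U)`_j.
  apply/colP => i; rewrite mxE summxE; apply: eq_bigr => j _.
  by rewrite !mxE mulrC.
exists P; split=> [c||v vU].
- rewrite PE; apply: rpred_sum => j _; apply: rpredZ.
  by apply: vbasis_mem; rewrite mem_nth // size_tuple.
- apply: linv_exists => c; rewrite PE => c0.
  have /freeP/(_ _ c0) cj := basis_free (vbasisP U).
  by apply/colP => j; rewrite cj mxE.
- exists (\col_j coord (vbasis U) j v); rewrite PE {1}(coord_vbasis vU).
  by apply: eq_bigr => j _; rewrite mxE.
Qed.

Lemma colspace_factor n m k (P : 'M[C]_(n, m)) P' (X : 'M[C]_(n, k)) :
  P' *m P = 1%:M -> (forall j, exists c, X *m delta_mx j (0 : 'I_1) = P *m c) ->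
  X = P *m (P' *m X).
Proof.
move=> P'P XP; apply/matrixP => i j; have [c Xc] := XP j.
have /colP/(_ i) : X *m delta_mx j (0 : 'I_1) = P *m (P' *m X) *m delta_mx j 0.
  by rewrite -mulmxA -mulmxA Xc (mulmxA P') P'P mul1mx.
by rewrite -!colE !mxE.
Qed.

(** Strong induction on [n]: a proper invariant subspace with basis matrix [P] carries the smaller
    family [P' *m (tau i *m P)]. *)
Lemma irr_sub (I : Type) n (tau : I -> 'M[C]_n) : (0 < n)%N ->
  exists d (rho : I -> 'M[C]_d) (P : 'M[C]_(n, d)),
    [/\ irr_family rho, exists P', P' *m P = 1%:M &
        forall i, tau i *m P = P *m rho i].
Proof.
elim/ltn_ind: n tau => n IH tau n0.
have [tauirr|] := EM (irr_family tau).
  exists n, tau, 1%:M; split=> //; first by exists 1%:M; rewrite mulmx1.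
  by move=> i; rewrite mulmx1 mul1mx.
move=> nirr; have [U [Uinv [U0 U1]]] : exists U : {vspace 'cV[C]_n},
    (forall i v, v \in U -> tau i *m v \in U) /\ (U <> 0%VS /\ U <> fullv).
  apply: contrapT => nU; apply: nirr; split=> // U Uinv.
  have [|U0] := EM (U = 0%VS); first by left.
  have [|U1] := EM (U = fullv); first by right.
  by case: nU; exists U.
have [P [PU [P' P'P] UP]] := vspace_mx U.
have dU : (\dim U < n)%N.
  rewrite ltnNge; apply/negP => nU; apply: U1; apply/eqP; rewrite eqEdim subvf /=.
  by rewrite dimvf /dim /= muln1.
have dU0 : (0 < \dim U)%N by rewrite lt0n dimv_eq0; apply/eqP.
pose tau' i := P' *m (tau i *m P).
have tau'P i : tau i *m P = P *m tau' i.
  by apply: colspace_factor => // j; rewrite -mulmxA; apply/UP/Uinv/PU.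
have [d [rho [Q [irho [Q' Q'Q] rhoQ]]]] := IH _ dU tau' dU0.
exists d, rho, (P *m Q); split=> //.
  by exists (Q' *m P'); rewrite -mulmxA (mulmxA P') P'P mul1mx.
by move=> i; rewrite mulmxA tau'P -mulmxA rhoQ mulmxA.
Qed.

Lemma eigen_exists n (M : 'M[C]_n) : (0 < n)%N ->
  exists a (v : 'cV_n), v != 0 /\ M *m v = a *: v.
Proof.
move=> n0; have : size (char_poly M^T) != 1%N by rewrite size_char_poly -lt0n.
move=> /closed_rootP[a]; rewrite -eigenvalue_root_char => /eigenvalueP[v vM v0].
exists a, v^T; split; first by rewrite trmx_eq0.
by rewrite -[M]trmxK -trmx_mul vM linearZ.
Qed.

Lemma scalar_mx_inj d (a b : C) : (0 < d)%N -> (a%:M : 'M[C]_d) = b%:M -> a = b.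
Proof.
by move=> d0 /matrixP/(_ (Ordinal d0) (Ordinal d0)); rewrite !mxE eqxx.
Qed.

(** One half of Schur's lemma: the image of [X] is invariant and non-zero, hence everything. *)
Lemma irr_coker (I : Type) d m (rho : I -> 'M[C]_d) (X : 'M[C]_(d, m)) (s : I -> 'M[C]_m) :
  irr_family rho -> (forall i, rho i *m X = X *m s i) -> X != 0 ->
  exists Y, X *m Y = 1%:M.
Proof.
move=> [_ irho] Xs X0; pose U := limg (linfun (mulmx X : 'cV_m -> 'cV_d)).
have memU v : v \in U -> exists c, v = X *m c.
  by move=> /memv_imgP[c _ ->]; exists c; rewrite lfunE.
have Umem c : X *m c \in U.
  by apply/memv_imgP; exists c; rewrite ?memvf ?lfunE.
have [|U0|U1] := irho U.
- by move=> i v /memU[c ->]; rewrite mulmxA Xs -mulmxA.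
- case/eqP: X0; apply/matrixP => i j; rewrite [RHS]mxE.
  by have := Umem (delta_mx j 0); rewrite U0 memv0 -colE => /eqP/colP/(_ i); rewrite !mxE.
- by apply: rinv_exists => v; apply: memU; rewrite U1 memvf.
Qed.

(** The dual half of Schur's lemma: the kernel of [X] is invariant and proper, hence zero. *)
Lemma irr_ker (I : Type) d m (rho : I -> 'M[C]_d) (X : 'M[C]_(m, d)) (s : I -> 'M[C]_m) :
  irr_family rho -> (forall i, X *m rho i = s i *m X) -> X != 0 ->
  exists Y, Y *m X = 1%:M.
Proof.
move=> [_ irho] Xs X0; pose U := lker (linfun (mulmx X : 'cV_d -> 'cV_m)).
have memU v : (v \in U) = (X *m v == 0) by rewrite memv_ker lfunE.
have [|U0|U1] := irho U.
- by move=> i v; rewrite !memU mulmxA Xs -mulmxA => /eqP->; rewrite mulmx0.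
- by apply: linv_exists => c /eqP; rewrite -memU U0 memv0 => /eqP.
- case/eqP: X0; apply/matrixP => i j; rewrite [RHS]mxE.
  have := memvf (delta_mx j 0 : 'cV[C]_d); rewrite -U1 memU -colE => /eqP/colP/(_ i).
  by rewrite !mxE.
Qed.

Lemma schur_scalar (I : Type) d (rho : I -> 'M[C]_d) (M : 'M[C]_d) :
  irr_family rho -> (forall i, rho i *m M = M *m rho i) -> exists a, M = a%:M.
Proof.
move=> irho rM; have [d0 _] := irho.
have [a [v [v0 Mv]]] := eigen_exists M d0; exists a.
apply/eqP; rewrite -subr_eq0; apply/negPn/negP => Ma.
have [|Y YM] := irr_ker (s := rho) irho _ Ma.
  by move=> i; rewrite mulmxBl mulmxBr rM scalar_mxC.
case/negP: v0; rewrite -[v]mul1mx -YM -mulmxA mulmxBl Mv mul_scalar_mx subrr.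
by rewrite mulmx0.
Qed.

(** An irreducible subfamily inside the image of [X] acts by scalars, by Schur, since its members
    commute. The matrix [X] serves to confine the eigenvector to a chosen invariant subspace. *)
Lemma commuting_eigenvector (I : Type) n m (tau : I -> 'M[C]_n) (X : 'M[C]_(n, m)) :
  (forall i j, tau i *m tau j = tau j *m tau i) ->
  (forall i, exists Q, tau i *m X = X *m Q) -> X != 0 ->
  exists (w : 'cV_m) (c : I -> C),
    X *m w != 0 /\ forall i, tau i *m (X *m w) = c i *: (X *m w).
Proof.
move=> tauC tauX X0.
pose U := limg (linfun (mulmx X : 'cV_m -> 'cV_n)).
have memU v : v \in U -> exists c, v = X *m c.
  by move=> /memv_imgP[c _ ->]; exists c; rewrite lfunE.
have [P [PU [P' P'P] UP]] := vspace_mx U.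
have dU0 : (0 < \dim U)%N.
  rewrite lt0n dimv_eq0; apply: contra X0 => /eqP U0.
  apply/eqP/matrixP => i j; rewrite [RHS]mxE.
  have : X *m delta_mx j 0 \in U by apply/memv_imgP; exists (delta_mx j 0); rewrite ?memvf ?lfunE.
  by rewrite U0 memv0 -colE => /eqP/colP/(_ i); rewrite !mxE.
have PQ i : tau i *m P = P *m (P' *m tau i *m P).
  rewrite -mulmxA; apply: colspace_factor => // j.
  rewrite -mulmxA; apply: UP; have [c ->] := memU _ (PU (delta_mx j 0)).
  have [Q QX] := tauX i; rewrite mulmxA QX -mulmxA.
  by apply/memv_imgP; exists (Q *m c); rewrite ?memvf ?lfunE.
have [d [rho [Q [irho [Q' Q'Q] rhoQ]]]] := irr_sub (fun i => P' *m tau i *m P) dU0.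
have PQrho i : tau i *m (P *m Q) = P *m Q *m rho i.
  by rewrite mulmxA PQ -mulmxA rhoQ mulmxA.
have QP : (Q' *m P') *m (P *m Q) = 1%:M by rewrite -mulmxA (mulmxA P') P'P mul1mx.
have rhoC i j : rho i *m rho j = rho j *m rho i.
  have : (P *m Q) *m (rho i *m rho j) = (P *m Q) *m (rho j *m rho i).
    by rewrite !mulmxA -!PQrho -!(mulmxA (tau _)) -!PQrho !mulmxA tauC.
  by move=> /(congr1 (mulmx (Q' *m P'))); rewrite 2!(mulmxA (Q' *m P') (P *m Q)) QP !mul1mx.
have /choice[c rhoc] : forall i, exists a, rho i = a%:M.
  by move=> i; apply: (schur_scalar irho) => j; apply: rhoC.
have [d0 _] := irho; pose e : 'cV[C]_d := delta_mx (Ordinal d0) 0.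
have [w wE] := memU _ (PU (Q *m e)); exists w, c; rewrite -wE; split.
  apply: contraTneq (oner_neq0 C) => PQe.
  have : e = 0 by rewrite -[e]mul1mx -QP -mulmxA -(mulmxA P) PQe mulmx0.
  by move=> /colP/(_ (Ordinal d0)); rewrite !mxE !eqxx => /eqP; rewrite oner_eq0.
by move=> i; rewrite (mulmxA P) mulmxA PQrho rhoc -mulmxA mul_scalar_mx -scalemxAr.
Qed.
End MatrixFamilies.

(** * Finite chain rings *)

Lemma card_fibers (S T : finType) (A : {set S}) (f : S -> T) (k : nat) :
  (forall x, x \in A -> #|[set y in A | f y == f x]| = k) -> #|A| = (#|f @: A| * k)%N.
Proof.
move=> fk; rewrite -sum1_card (partition_big_imset f) /= -sum_nat_const.
apply: eq_bigr => c /imsetP[x xA ->]; rewrite -(fk x xA) -sum1_card.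
by apply: eq_bigl => y; rewrite inE.
Qed.

Lemma card_pairs (T1 T2 : finType) (P : T1 -> T2 -> bool) :
  #|[set p : T1 * T2 | P p.1 p.2]| = \sum_x #|[set y | P x y]|.
Proof.
rewrite -sum1_card (eq_bigl (fun p : T1 * T2 => true && P p.1 p.2)); last first.
  by move=> p; rewrite inE.
rewrite -(pair_big_dep xpredT P (fun _ _ => 1%N)) /=.
by apply: eq_bigr => x _; rewrite sum1_card; apply: eq_card => y; rewrite !inE.
Qed.

Lemma card_pairs_swap (T1 T2 : finType) (P : T1 -> T2 -> bool) :
  #|[set p : T1 * T2 | P p.1 p.2]| = #|[set p : T2 * T1 | P p.2 p.1]|.
Proof.
have swapK (U V : Type) : cancel (fun p : U * V => (p.2, p.1)) (fun p => (p.2, p.1)).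
  by case.
rewrite -(on_card_preimset (f := fun p : T2 * T1 => (p.2, p.1))).
  by apply: eq_card => p; rewrite !inE.
by exists (fun p => (p.2, p.1)) => p _; apply: swapK.
Qed.

(* q is the size of the socle, which is also that of the residue field. *)
Definition chain_ring (B : finComNzRingType) (pi : B) (e q : nat) : Prop :=
  [/\ (0 < e)%N, pi ^+ e = 0 /\ pi ^+ e.-1 != 0,
      forall x : B, (exists y, x * y = 1) \/ (exists y, x = pi * y) &
      #|[set x : B | pi * x == 0]| = q].

Section ChainRing.
Variables (B : finComNzRingType) (pi : B) (e q : nat).
Hypothesis Bchain : chain_ring pi e q.

Let e0 : (0 < e)%N. Proof. by case: Bchain. Qed.
Let pie : pi ^+ e = 0. Proof. by case: Bchain => _ []. Qed.

Lemma unif_exp_eq0 j : (pi ^+ j == 0) = (e <= j)%N.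
Proof.
case: Bchain => _ [_ pie'] _ _; apply/idP/idP => [|ej]; last first.
  by rewrite -(subnK ej) exprD pie mulr0.
apply: contraTT; rewrite -ltnNge => je; apply: contra pie' => /eqP pij.
have /subnK <- : (j <= e.-1)%N by lia.
by rewrite exprD pij mulr0.
Qed.

(** Factors [pi] are peeled off until a unit remains or [pi ^+ e] divides [x]; in the latter case
    [x = 0] is written [1 * pi ^+ e]. *)
Lemma chain_decomp x :
  exists u j, [/\ x = u * pi ^+ j, exists u', u * u' = 1 & (j <= e)%N].
Proof.
have [_ _ Bu _] := Bchain.
have [//|[y ->]] : (exists u j, [/\ x = u * pi ^+ j, exists u', u * u' = 1 & (j <= e)%N])
    \/ (exists y, x = y * pi ^+ e); last first.
  by exists 1, e; rewrite pie !mulr0; split=> //; exists 1; rewrite mulr1.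
suff: forall n, (n <= e)%N ->
   (exists u j, [/\ x = u * pi ^+ j, exists u', u * u' = 1 & (j <= e)%N])
    \/ (exists y, x = y * pi ^+ n) by move/(_ e (leqnn e)).
elim=> [|n IH] ne; first by right; exists x; rewrite mulr1.
have [|[y xy]] := IH (ltnW ne); first by left.
have [yu|[y' yy']] := Bu y; first by left; exists y, n; split=> //; apply: ltnW.
by right; exists y'; rewrite xy yy' exprS; ring.
Qed.

Definition dvdB (x y : B) := [exists z, y == x * z].

Lemma dvdBP x y : reflect (exists z, y = x * z) (dvdB x y).
Proof. by apply: (iffP existsP) => -[z] => [/eqP|] ->; exists z. Qed.

Lemma dvdB_mulr x y z : dvdB x y -> dvdB x (y * z).
Proof. by move=> /dvdBP[w ->]; apply/dvdBP; exists (w * z); rewrite mulrA. Qed.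

Lemma dvdB_exp i j : (i <= j)%N -> dvdB (pi ^+ i) (pi ^+ j).
Proof. by move=> ij; apply/dvdBP; exists (pi ^+ (j - i)); rewrite -exprD subnKC. Qed.

Lemma dvdB_total x y : dvdB x y \/ dvdB y x.
Proof.
have [u [j [-> [u' uu'] _]]] := chain_decomp x.
have [v [k [-> [v' vv'] _]]] := chain_decomp y.
have [jk|kj] := leqP j k; [left|right]; apply/dvdBP.
  by exists (u' * v * pi ^+ (k - j)); rewrite -(subnK jk) exprD addnK -[LHS]mul1r -uu'; ring.
by exists (v' * u * pi ^+ (j - k)); rewrite -{1}(subnK (ltnW kj)) exprD -[LHS]mul1r -vv'; ring.
Qed.

Lemma unif_ann j x : (j <= e)%N -> (pi ^+ j * x == 0) = dvdB (pi ^+ (e - j)) x.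
Proof.
move=> je; apply/idP/dvdBP => [|[y ->]]; last first.
  by rewrite mulrA -exprD subnKC // pie mul0r.
have [u [i [-> [u' uu'] _]]] := chain_decomp x; move=> /eqP pix.
have : pi ^+ (j + i) == 0.
  by apply/eqP; rewrite exprD -[LHS]mulr1 -uu' -[RHS](mul0r u') -pix; ring.
rewrite unif_exp_eq0 => eji; have /subnK <- : (e - j <= i)%N by lia.
by exists (u * pi ^+ (i - (e - j))); rewrite exprD; ring.
Qed.

Definition unif_ideal j := [set x | dvdB (pi ^+ j) x].
Definition ann (b : B) := [set x : B | b * x == 0].

Lemma card_translate (S : {set B}) (b x0 : B) : (forall x, b * x = 0 -> (x + x0 \in S)) ->
  #|[set y in S | b * y == b * x0]| = #|ann b|.
Proof.
move=> bS; rewrite -(card_imset (ann b) (addIr x0)); apply: eq_card => y.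
rewrite !inE; apply/andP/imsetP => [[yS /eqP byx]|[x]].
  by exists (y - x0); rewrite ?subrK // inE mulrBr byx subrr.
by rewrite inE => /eqP bx ->; rewrite bS // mulrDr bx add0r.
Qed.

(** Downward induction from [pi ^+ e = 0]: multiplication by [pi] maps each ideal onto the next
    smaller one, with fibres of the size [q] of the socle. *)
Lemma card_unif_ideal j : (j <= e)%N -> #|unif_ideal j| = (q ^ (e - j))%N.
Proof.
move=> je; rewrite -[in LHS](subKn je).
have : (e - j <= e)%N by lia.
elim: (e - j)%N => [|n IH] ne.
  rewrite subn0 expn0; apply/eqP/cards1P; exists 0; apply/setP => x.
  rewrite !inE pie; apply/dvdBP/eqP => [[z ->]|->]; first by rewrite mul0r.
  by exists 0; rewrite mul0r.
rewrite expnSr -IH; last exact: ltnW.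
have -> : unif_ideal (e - n) = [set pi * x | x in unif_ideal (e - n.+1)].
  apply/setP => x; rewrite inE; apply/dvdBP/imsetP => [[z ->]|[y]].
    exists (pi ^+ (e - n.+1) * z); first by rewrite inE; apply/dvdBP; exists z.
    by rewrite mulrA -exprS; congr (_ ^+ _ * _); lia.
  rewrite inE => /dvdBP[z ->] ->; exists z; rewrite mulrA -exprS.
  by congr (_ ^+ _ * _); lia.
apply: card_fibers => x; rewrite inE => xD.
have [_ _ _ <-] := Bchain; apply: card_translate => y piy; rewrite inE.
(* The socle lies in every non-zero ideal, so translating by it does not leave
   [unif_ideal (e - n.+1)]. *)
have : dvdB (pi ^+ (e - 1)) y by rewrite -unif_ann // expr1 piy.
move=> /dvdBP[z ->]; move/dvdBP: xD => [w ->]; apply/dvdBP.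
have /subnK <- : (e - n.+1 <= e - 1)%N by lia.
by exists (pi ^+ (e - 1 - (e - n.+1)) * z + w); rewrite exprD; ring.
Qed.

Lemma chain_card : #|B| = (q ^ e)%N.
Proof.
rewrite -[e in RHS]subn0 -card_unif_ideal // -cardsT; apply: eq_card => x.
by rewrite !inE; apply/esym/dvdBP; exists x; rewrite mul1r.
Qed.

Lemma unif_res_gt1 : (1 < q)%N.
Proof.
have : (1 < #|B|)%N.
  by rewrite -cardsT; apply/card_gt1P; exists 0, 1; rewrite !inE eq_sym oner_eq0.
rewrite chain_card; case: q => [|[|//]]; first by rewrite exp0n.
by rewrite exp1n.
Qed.

Lemma ann_unit_exp u u' j : u * u' = 1 -> (j <= e)%N -> ann (u * pi ^+ j) = unif_ideal (e - j).
Proof.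
move=> uu' je; apply/setP => x; rewrite !inE -unif_ann //.
apply/eqP/eqP => [ux|px]; last by rewrite -mulrA px mulr0.
by rewrite -[LHS]mul1r -uu' -[RHS](mulr0 u') -ux; ring.
Qed.

Lemma card_ann u u' j : u * u' = 1 -> (j <= e)%N -> #|ann (u * pi ^+ j)| = (q ^ j)%N.
Proof.
by move=> uu' je; rewrite (ann_unit_exp uu') // card_unif_ideal ?leq_subr // subKn.
Qed.

Lemma card_lin (b c : B) : #|[set x | b * x == c]| = if dvdB b c then #|ann b| else 0%N.
Proof.
case: dvdBP => [[x0 ->]|nc].
  rewrite -(card_translate (S := [set: B]%SET) (x0 := x0)) => [|x _]; last by rewrite inE.
  by apply: eq_card => x; rewrite !inE.
apply: eq_card0 => x; rewrite inE; apply/negP => /eqP bx.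
by case: nc; exists x.
Qed.

(** One triangular half of the linear system for the kernel of R(a, A), once A is diagonal. *)
Definition pair_ker (a b c : B) := [set p : B * B | (c * p.1 == 0) && (a * p.1 + b * p.2 == 0)].

(** With p = (x, y), the equation c x = 0 means pi^(e - l) | x, and solvability in y requires pi^(k
    - h) | x, the difference being truncated; each such x leaves q^k values of y. The symmetry of
    the result in k and l is what makes the two halves of the kernel equally large. *)
Lemma card_pair_ker a b c h k l :
  (exists u u', a = u * pi ^+ h /\ u * u' = 1) ->
  (exists u u', b = u * pi ^+ k /\ u * u' = 1) ->
  (exists u u', c = u * pi ^+ l /\ u * u' = 1) -> (h <= e)%N -> (k <= e)%N -> (l <= e)%N ->
  #|pair_ker a b c| = (q ^ minn (k + l) (e + h))%N.
Proof.
move=> [u [u' [aE uu']]] [v [v' [bE vv']]] [w [w' [cE ww']]] he ke le.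
rewrite /pair_ker (card_pairs (fun x y => (c * x == 0) && (a * x + b * y == 0))).
transitivity (\sum_(x in unif_ideal (maxn (e - l) (k - h))) q ^ k)%N; last first.
  rewrite sum_nat_const card_unif_ideal; last by lia.
  by rewrite -expnD; congr (_ ^ _)%N; lia.
rewrite [RHS]big_mkcond /=; apply: eq_bigr => x _.
have -> : [set y | (c * x == 0) && (a * x + b * y == 0)] =
    if c * x == 0 then [set y | b * y == - (a * x)] else finset.set0.
  case: ifP => _; apply/setP => y; rewrite !inE // addrC addr_eq0 //.
have -> : (x \in unif_ideal (maxn (e - l) (k - h))) = (c * x == 0) && dvdB b (- (a * x)).
  have -> : (c * x == 0) = (x \in unif_ideal (e - l)) by rewrite -(ann_unit_exp ww') // -cE inE.
  rewrite !inE /maxn; have [lt|le'] := ltnP.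
    apply/idP/andP => [xD|[_]].
      split; first by move/dvdBP: xD => [z ->]; apply/dvdB_mulr/dvdB_exp/ltnW.
      move/dvdBP: xD => [z ->]; rewrite aE bE; apply/dvdBP.
      exists (- (v' * u * z)); have hk : (h <= k)%N by lia.
      rewrite -[in RHS](subnKC hk) exprD -[LHS]mul1r -vv'; ring.
    move=> /dvdBP[z]; rewrite aE bE => /eqP.
    rewrite eqr_oppLR => /eqP axz; have hk : (h <= k)%N by lia.
    have : pi ^+ h * (x + u' * v * pi ^+ (k - h) * z) == 0.
      apply/eqP; rewrite mulrDr -[X in X + _]mul1r -uu'.
      have -> : u * u' * (pi ^+ h * x) = u' * (u * pi ^+ h * x) by ring.
      rewrite axz -[in X in X + _](subnKC hk) exprD; ring.
    (* The equation determines [x] up to the annihilator of pi^h, generated by pi^(e - h), and this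
       is a multiple of pi^(k - h) because k <= e. *)
    rewrite unif_ann // => /dvdBP[t xt].
    have -> : x = pi ^+ (e - h) * t - u' * v * pi ^+ (k - h) * z by rewrite -xt addrK.
    apply/dvdBP; exists (pi ^+ (e - h - (k - h)) * t - u' * v * z).
    by rewrite mulrBr mulrA -exprD subnKC; [ring|lia].
  case xD: (dvdB _ x) => //=; apply/esym; move/dvdBP: xD => [z ->].
  have -> : - (a * (pi ^+ (e - l) * z)) = pi ^+ k * (- u * pi ^+ (h + (e - l) - k) * z).
    transitivity (- u * (pi ^+ h * pi ^+ (e - l)) * z); first by rewrite aE; ring.
    rewrite -exprD -[in LHS](@subnKC k (h + (e - l))); last by lia.
    by rewrite exprD; ring.
  apply/dvdB_mulr/dvdBP; exists v'.
  by rewrite bE -[LHS]mul1r -vv'; ring.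
case: (c * x == 0) => /=; last by rewrite cards0.
by rewrite card_lin bE (card_ann vv').
Qed.

(* Kernel of R(a, A) on B^4, for A = [[w, x], [y, z]]. *)
Definition kerset (a w x y z : B) := [set v : B * B * B * B |
  let: (u1, u2, w1, w2) := v in
  [&& a * u2 + w * w1 + x * w2 == 0, - a * u1 + y * w1 + z * w2 == 0,
      w * u1 + y * u2 == 0 & x * u1 + z * u2 == 0]].

Definition ker_spec (a w x y z : B) := exists i,
  [/\ #|kerset a w x y z| = ((q ^ i) ^ 2)%N, (i <= 2 * e)%N,
      (e <= i)%N = (w * z - x * y == 0) &
      (e < i)%N -> [/\ dvdB pi a, dvdB pi w, dvdB pi x, dvdB pi y & dvdB pi z]].

(* Unimodular row and column operations turn A into diag(w, c) with det A = w c,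
   and the kernel splits into two factors of equal size. *)
Lemma ker_spec_dvd a w x y z : dvdB w x -> dvdB w y -> dvdB w z -> ker_spec a w x y z.
Proof.
move=> /dvdBP[x' ->] /dvdBP[y' ->] /dvdBP[z' ->].
pose c := w * (z' - x' * y').
have [ua [h [aE [ua' uua] he]]] := chain_decomp a.
have [uw [k [wE [uw' uuw] ke]]] := chain_decomp w.
have [uc [l [cE [uc' uuc] le]]] := chain_decomp c.
have pdvd u j : (0 < j)%N -> dvdB pi (u * pi ^+ j).
  by case: j => // j _; apply/dvdBP; exists (u * pi ^+ j); rewrite exprS; ring.
(* Both halves have this exponent, by the symmetry of [card_pair_ker]. *)
exists (minn (k + l) (e + h)); split.
- pose phi (v : B * B * B * B) := let: (u1, u2, w1, w2) := v in
    ((u2, w1 + x' * w2), (u1 + y' * u2, w2)).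
  pose phi' (v : (B * B) * (B * B)) := let: ((u2, w1), (u1, w2)) := v in
    (u1 - y' * u2, u2, w1 - x' * w2, w2).
  have phiK : cancel phi phi' by move=> [[[u1 u2] w1] w2] /=; rewrite !addrK.
  have phi'K : cancel phi' phi by move=> [[u2 w1] [u1 w2]] /=; rewrite !subrK.
  have -> : kerset a w (w * x') (w * y') (w * z') =
      phi @^-1: finset.setX (pair_ker a w c) (pair_ker (- a) c w).
    apply/setP => -[[[u1 u2] w1] w2]; rewrite !inE /=.
    have E1 : a * u2 + w * w1 + w * x' * w2 = a * u2 + w * (w1 + x' * w2) by ring.
    have E2 : - a * u1 + w * y' * w1 + w * z' * w2 =
      y' * (a * u2 + w * (w1 + x' * w2)) + (- a * (u1 + y' * u2) + c * w2).
      by rewrite /c; ring.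
    have E3 : w * u1 + w * y' * u2 = w * (u1 + y' * u2) by ring.
    have E4 : w * x' * u1 + w * z' * u2 = x' * (w * (u1 + y' * u2)) + c * u2.
      by rewrite /c; ring.
    rewrite E1 E2 E3 E4; case: (a * u2 + _ =P 0) => [->|]; last by rewrite andbF.
    case: (w * (u1 + _) =P 0) => [->|]; last by rewrite !andbF.
    by rewrite !mulr0 !add0r !andbT /= andbC.
  rewrite on_card_preimset; last by exists phi' => v _; [apply: phiK|apply: phi'K].
  rewrite cardsX (@card_pair_ker a w c h k l) //; last 3 first.
  + by exists ua, ua'.
  + by exists uw, uw'.
  + by exists uc, uc'.
  rewrite (@card_pair_ker (- a) c w h l k) //; last 3 first.
  + by exists (- ua), (- ua'); rewrite aE mulNr mulrNN.
  + by exists uc, uc'.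
  + by exists uw, uw'.
  by rewrite (addnC l) mulnn.
- lia.
- have -> : w * (w * z') - w * x' * (w * y') = w * c by rewrite /c; ring.
  have -> : (w * c == 0) = (e <= k + l)%N.
    rewrite -unif_exp_eq0 exprD; apply/eqP/eqP => [wc|pp].
      rewrite -[LHS]mul1r -uuw -[LHS]mul1r -uuc.
      have -> : uc * uc' * (uw * uw' * (pi ^+ k * pi ^+ l)) =
        uc' * uw' * ((uw * pi ^+ k) * (uc * pi ^+ l)) by ring.
      by rewrite -wE -cE wc mulr0.
    rewrite wE cE; have -> : uw * pi ^+ k * (uc * pi ^+ l) = uw * uc * (pi ^+ k * pi ^+ l) by ring.
    by rewrite pp mulr0.
  lia.
- move=> ei; have pw : dvdB pi w by rewrite wE; apply: pdvd; lia.
  by split=> //; rewrite ?aE; first (by apply: pdvd; lia); apply: dvdB_mulr.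
Qed.

Lemma dvdB_trans y x z : dvdB x y -> dvdB y z -> dvdB x z.
Proof. by move=> xy /dvdBP[t ->]; apply: dvdB_mulr. Qed.

Lemma dvdB_refl x : dvdB x x.
Proof. by apply/dvdBP; exists 1; rewrite mulr1. Qed.

Lemma ker_spec_colswap a w x y z : ker_spec a x w z y -> ker_spec a w x y z.
Proof.
move=> [i [iK ie idet ipi]]; exists i; split=> //.
- rewrite -iK.
  pose phi (v : B * B * B * B) := let: (u1, u2, w1, w2) := v in (u1, u2, w2, w1).
  have phiK : involutive phi by move=> [[[u1 u2] w1] w2].
  have -> : kerset a w x y z = phi @^-1: kerset a x w z y.
    apply/setP => -[[[u1 u2] w1] w2]; rewrite !inE /=.
    by rewrite -!(addrA (a * _)) -!(addrA (- a * _)) (addrC (w * w1)) (addrC (y * w1)) (andbC (w * _ + _ == _)).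
  by rewrite on_card_preimset //; exists phi => v _; apply: phiK.
- by rewrite idet -oppr_eq0 opprB.
- by move=> /ipi[].
Qed.

(** Exchanging the rows exchanges [u1] and [u2], which changes the sign of J; hence [- a]. *)
Lemma ker_spec_rowswap a w x y z : ker_spec (- a) y z w x -> ker_spec a w x y z.
Proof.
move=> [i [iK ie idet ipi]]; exists i; split=> //.
- rewrite -iK.
  pose phi (v : B * B * B * B) := let: (u1, u2, w1, w2) := v in (u2, u1, w1, w2).
  have phiK : involutive phi by move=> [[[u1 u2] w1] w2].
  have -> : kerset a w x y z = phi @^-1: kerset (- a) y z w x.
    apply/setP => -[[[u1 u2] w1] w2]; rewrite !inE /= opprK.
    by rewrite andbCA (addrC (y * u2)) (addrC (z * u2)).
  by rewrite on_card_preimset //; exists phi => v _; apply: phiK.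
- by rewrite idet -oppr_eq0 opprB (mulrC x) (mulrC z).
- move=> /ipi[]; case/dvdBP=> t /eqP; rewrite eqr_oppLR -mulrN => /eqP-> *; split=> //.
  by apply/dvdB_mulr/dvdB_refl.
Qed.

(** Divisibility is total in a chain ring, so some entry divides the other three, and swaps bring it
    to the top left corner. *)
Lemma ker_card a w x y z : ker_spec a w x y z.
Proof.
have [wx|xw] := dvdB_total w x; have [yz|zy] := dvdB_total y z.
- have [wy|yw] := dvdB_total w y.
    by apply: ker_spec_dvd => //; apply: dvdB_trans yz.
  by apply/ker_spec_rowswap/ker_spec_dvd => //; apply: dvdB_trans wx.
- have [wz|zw] := dvdB_total w z.
    by apply: ker_spec_dvd => //; apply: dvdB_trans zy.
  by apply/ker_spec_rowswap/ker_spec_colswap/ker_spec_dvd => //; apply: dvdB_trans wx.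
- have [xy|yx] := dvdB_total x y.
    by apply/ker_spec_colswap/ker_spec_dvd => //; apply: dvdB_trans yz.
  by apply/ker_spec_rowswap/ker_spec_dvd => //; apply: dvdB_trans xw.
- have [xz|zx] := dvdB_total x z.
    by apply/ker_spec_colswap/ker_spec_dvd => //; apply: dvdB_trans zy.
  by apply/ker_spec_rowswap/ker_spec_colswap/ker_spec_dvd => //; apply: dvdB_trans xw.
Qed.

(* Summing over (w, x) and exchanging the sums, the number of singular matrices is
   |B| times the sum over c of |ann c|^2. *)
Lemma card_det0_row w x :
  #|[set p : B * B | w * p.2 == x * p.1]| =
  (#|B| * #|[set c | (c * w == 0)%R && (c * x == 0)%R]|)%N.
Proof.
have [/dvdBP[x' ->]|/dvdBP[w' ->]] := dvdB_total w x.
  rewrite (card_pairs (fun y z => w * z == w * x' * y)).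
  rewrite -cardsT -sum_nat_const; apply: eq_big => y; rewrite ?inE // => _.
  rewrite card_lin ifT; last by apply/dvdB_mulr/dvdB_mulr/dvdB_refl.
  apply: eq_card => c; rewrite !inE mulrA (mulrC c).
  by case: eqP => [->|//]; rewrite mul0r eqxx.
rewrite (card_pairs_swap (fun y z => x * w' * z == x * y)).
rewrite (card_pairs (fun z y => x * w' * z == x * y)).
rewrite -cardsT -sum_nat_const; apply: eq_big => y; rewrite ?inE // => _.
transitivity #|[set y0 | x * y0 == x * w' * y]|.
  by apply: eq_card => t; rewrite !inE eq_sym.
rewrite card_lin ifT; last by apply/dvdB_mulr/dvdB_mulr/dvdB_refl.
apply: eq_card => c; rewrite !inE mulrA (mulrC c) andbC.
by case: eqP => [->|//]; rewrite mul0r eqxx.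
Qed.

(** Layer-cake summation: |ann c|^2 is 1 plus the jumps q^(2i + 2) - q^(2i) over the i < e with c in
    (pi^(i + 1)); exchanging the sums leaves a geometric series. The factor q and the term q^e keep
    the identity free of division and subtraction. *)
Lemma sum_card_ann2 : (q * \sum_(c : B) #|ann c| ^ 2 + q ^ e = q ^ (2 * e).+1 + q ^ (2 * e))%N.
Proof.
have q1 := unif_res_gt1.
have annE c : (#|ann c| ^ 2 = 1 + \sum_(i < e) (c \in unif_ideal i.+1) * (q ^ (2 * i).+2 - q ^ (2 * i)))%N.
  have [u [j [cE [u' uu'] je]]] := chain_decomp c.
  rewrite cE (card_ann uu') // -expnM mulnC.
  have inD i : (i <= e)%N -> (u * pi ^+ j \in unif_ideal i) = (i <= j)%N.
    move=> ie; have := ann_unit_exp (mulr1 1) (leq_subr i e).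
    rewrite subKn // => <-; rewrite inE mul1r mulrCA -exprD.
    transitivity (pi ^+ (e - i + j) == 0); last by rewrite unif_exp_eq0; lia.
    apply/eqP/eqP => [up|->]; last by rewrite mulr0.
    by rewrite -[LHS]mul1r -uu' (mulrC u) -mulrA up mulr0.
  rewrite (eq_bigr (fun i : 'I_e => (i < j) * (q ^ (2 * i).+2 - q ^ (2 * i)))%N); last first.
    by move=> i _; rewrite inD.
  rewrite -(big_mkord xpredT (fun i => (i < j) * (q ^ (2 * i).+2 - q ^ (2 * i)))%N).
  rewrite (big_cat_nat (leq0n j) je) //= [X in (_ + (_ + X))%N]big_nat_cond.
  rewrite [X in (_ + (_ + X))%N]big1 ?addn0; last by move=> i; rewrite andbT => ?; rewrite ltnNge; lia.
  clear -q1; elim: j => [|j IH]; first by rewrite big_nil.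
  rewrite big_nat_recr //= ltnSn mul1n.
  rewrite big_nat_cond (eq_bigr (fun i => (i < j) * (q ^ (2 * i).+2 - q ^ (2 * i)))%N); last first.
    by move=> i; rewrite andbT => /andP[_ ij]; rewrite ij ltnS ltnW.
  rewrite -big_nat_cond addnA -IH; have : (q ^ (2 * j) <= q ^ (2 * j).+2)%N.
    by apply: leq_pexp2l; [apply: ltnW|lia].
  have -> : (2 * j.+1 = (2 * j).+2)%N by lia.
  lia.
rewrite (eq_bigr _ (fun c _ => annE c)) big_split /= sum1_card chain_card exchange_big /=.
rewrite (eq_bigr (fun i : 'I_e => (q ^ 2 - 1) * (q ^ e.-1 * q ^ i))%N); last first.
  move=> i _; rewrite -big_distrl /=.
  transitivity (#|unif_ideal i.+1| * (q ^ (2 * i).+2 - q ^ (2 * i)))%N.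
    by rewrite -sum1_card [in RHS]big_mkcond; congr (_ * _)%N; apply: eq_bigr => c _; case: (c \in _).
  rewrite card_unif_ideal // -[(2 * i).+2]addn2 expnD -{2}[(q ^ (2 * i))%N]muln1 -mulnBr.
  rewrite mulnA -expnD mulnC -expnD; congr (_ * q ^ _)%N; have := ltn_ord i; lia.
rewrite -!big_distrr /=.
have S_geo : (q ^ e = q.-1 * (\sum_(i < e) q ^ i) + 1)%N.
  by rewrite -predn_exp addn1 prednK // expn_gt0; lia.
have qe : (q ^ e = q * q ^ e.-1)%N by rewrite -expnS prednK.
have -> : (q ^ (2 * e).+1 = q * q ^ e * q ^ e)%N.
  by rewrite -mulnA -expnD -expnS; congr (q ^ _)%N; lia.
have -> : (q ^ (2 * e) = q ^ e * q ^ e)%N by rewrite -expnD; congr (q ^ _)%N; lia.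
move: (q ^ e.-1)%N (\sum_(i < e) _)%N (q ^ e)%N S_geo qe => Q S W.
case: q q1 => // a _ /= WS WQ.
have -> : (a.+1 ^ 2 - 1 = a * a.+2)%N by lia.
transitivity (a.+1 * W + a.+2 * W * (a * S) + W)%N; first by rewrite {4}WQ; ring.
transitivity (a.+2 * W * W)%N; last by ring.
by rewrite {5}WS; ring.
Qed.

Lemma card_det0 :
  (q * #|[set s : (B * B) * (B * B) | (s.1.1 * s.2.2 == s.1.2 * s.2.1)%R]| + q ^ (2 * e) =
   q ^ (3 * e).+1 + q ^ (3 * e))%N.
Proof.
rewrite (card_pairs (fun r1 r2 : B * B => r1.1 * r2.2 == r1.2 * r2.1)).
rewrite (eq_bigr _ (fun r _ => card_det0_row r.1 r.2)) -big_distrr /=.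
rewrite -(card_pairs (fun (r : B * B) c => (c * r.1 == 0) && (c * r.2 == 0))).
rewrite (card_pairs_swap (fun (r : B * B) c => (c * r.1 == 0) && (c * r.2 == 0))).
rewrite (card_pairs (fun c (r : B * B) => (c * r.1 == 0) && (c * r.2 == 0))).
rewrite (eq_bigr (fun c => #|ann c| ^ 2)%N); last first.
  by move=> c _; rewrite -mulnn -cardsX; apply: eq_card => r; rewrite !inE.
rewrite chain_card; have := sum_card_ann2.
have -> : (q ^ (3 * e).+1 = q ^ e * q ^ (2 * e).+1)%N by rewrite -expnD; congr (_ ^ _)%N; lia.
have -> : (q ^ (3 * e) = q ^ e * q ^ (2 * e))%N by rewrite -expnD; congr (_ ^ _)%N; lia.
rewrite mul2n -addnn expnD -mulnDr => <-; rewrite mulnDr; ring.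
Qed.
End ChainRing.

Local Open Scope classical_set_scope.
Local Open Scope quotient_scope.
Lemma not_inj_nat (T : finType) (f : nat -> T) : exists i j, (i < j)%N /\ f i = f j.
Proof.
pose g (i : 'I_#|T|.+1) := f i.
have /injectivePn[i [j ij fij]] : ~~ injectiveb g.
  by apply/injectiveP => /leq_card; rewrite card_ord ltnn.
case: (ltngtP i j) => [lt|lt|/val_inj eq]; first by exists i, j.
  by exists j, i.
by rewrite eq eqxx in ij.
Qed.

(** * The ring of integers at a prime ideal *)

Section RingOfIntegers.
Variable K : fieldExtType rat.
Local Notation A := (ring_of_integers K).

Lemma int_valM (x y : A) : int_val (x * y) = int_val x * int_val y. Proof. by []. Qed.
Lemma int_val_inj (x y : A) : int_val x = int_val y -> x = y.
Proof. exact: val_inj. Qed.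

Lemma int_valz (n : int) : int_val (n%:~R : A) = n%:~R.
Proof. exact: (rmorph_int (val : A -> K)). Qed.

Lemma int_valn (n : nat) : int_val (n%:R : A) = n%:R.
Proof. exact: (rmorph_nat (val : A -> K)). Qed.

Lemma ring_of_integers_domain (x y : A) : x * y = 0 -> x = 0 \/ y = 0.
Proof.
move=> /(congr1 (@int_val K)); rewrite int_valM => /eqP.
by rewrite mulf_eq0 => /orP[] /eqP ?; [left|right]; apply: int_val_inj.
Qed.

Lemma natA_neq0 n : (0 < n)%N -> (n%:R : A) <> 0.
Proof.
move=> n0 /(congr1 (@int_val K)); rewrite int_valn => /eqP.
have -> : n%:R = (n%:R : rat)%:A :> K by rewrite -scaler_nat.
by rewrite scaler_eq0 oner_eq0 orbF pnatr_eq0; lia.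
Qed.

Lemma mulAI (x y z : A) : x <> 0 -> x * y = x * z -> y = z.
Proof.
move=> x0 /eqP; rewrite -subr_eq0 -mulrBr => /eqP/ring_of_integers_domain[//|].
by move=> /eqP; rewrite subr_eq0 => /eqP.
Qed.

(** A zero constant term is removed by dividing by the variable and cancelling [x]. The constant
    term that remains is a non-zero integer divisible by [x]. *)
Lemma integral_const (x : A) : x <> 0 ->
  exists2 P : {poly int}, P`_0 != 0 & (map_poly intr P).[x] = 0.
Proof.
move=> x0; have /asboolP[P Pm Px] := int_valP x.
have {Px} : (map_poly intr P).[x] = 0.
  apply: int_val_inj; have /rootP := Px.
  have -> : map_poly intr P = map_poly (val : A -> K) (map_poly intr P) :> {poly K}.
    rewrite -map_poly_comp; apply: eq_map_poly => n; exact/esym/int_valz.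
  by rewrite (horner_map (val : {rmorphism A -> K})).
have : P != 0 by apply: monic_neq0.
have [n] := ubnP (size P); elim: n P {Pm} => [|n IH] P //= Pn P0 Px.
have [P00|] := eqVneq P`_0 0; last by exists P.
have /factor_theorem[Q PQ] : root P 0 by rewrite rootE horner_coef0 P00.
move: Px; rewrite PQ rmorphM /= hornerM rmorphB /= map_polyX polyC0 rmorph0 subr0 hornerX.
move=> /ring_of_integers_domain[Qx|//]; apply: (IH Q) => //.
  by move: Pn; rewrite PQ polyC0 subr0 size_mulX //; apply: contraNneq P0 => Q0; rewrite PQ Q0 mul0r.
by apply: contraNneq P0 => Q0; rewrite PQ Q0 mul0r.
Qed.

Section Prime.
Variable p : prime_idealr A.

(** A non-zero element of [p] divides a non-zero integer, so [p] contains a positive integer and,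
    being prime, one of its prime factors. *)
Lemma prime_nat_mem : (exists2 x, x \in p & x != 0) -> exists2 l : nat, prime l & l%:R \in p.
Proof.
move=> [x xp /eqP x0]; have [P P0 Px] := integral_const x0.
have {P P0 Px}[c cp c0] : exists2 c : int, c%:~R \in p & c != 0.
  exists P`_0 => //; have /factor_theorem[Q PQ] : root (P - (P`_0)%:P) 0.
    by rewrite rootE hornerD hornerN hornerC horner_coef0 subrr.
  move: Px; rewrite -[P](subrK (P`_0)%:P) PQ polyC0 subr0 rmorphD rmorphM /= map_polyX map_polyC /=.
  rewrite hornerD hornerM hornerX hornerC => /eqP; rewrite addrC addr_eq0 => /eqP.
  by rewrite coefD coefMX coefC /= add0r => ->; rewrite rpredN; apply: idealMr.
have : `|c|%:R \in p.
  by case: c cp {c0} => n //=; rewrite NegzE mulrNz rpredN.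
have : (0 < `|c|)%N by rewrite absz_gt0.
move: `|c|%N => n {c cp c0}; elim/ltn_ind: n => n IH n0 np.
have [n1|n1] := leqP n 1.
  have n1E : n = 1%N by lia.
  by move: np; rewrite n1E idealr1.
have [//|] : (pdiv n)%:R \in p \/ (n %/ pdiv n)%:R \in p.
- by apply/orP; rewrite -prime_idealrM -natrM mulnC divnK // pdiv_dvd.
- by exists (pdiv n) => //; apply: pdiv_prime.
- apply: IH; first by apply: ltn_Pdiv => //; apply: prime_gt1; apply: pdiv_prime.
  by rewrite divn_gt0 ?pdiv_gt0 // pdiv_leq.
Qed.
End Prime.

(** * Finiteness of the ring of integers modulo a prime number *)

Section ModPrime.
Variable l : nat.
Hypothesis l_pr : prime l.

Definition in_mulA (x : A) := exists y, x = l%:R * y.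

Lemma in_mulAD x y : in_mulA x -> in_mulA y -> in_mulA (x + y).
Proof. by move=> [u ->] [v ->]; exists (u + v); rewrite mulrDr. Qed.
Lemma in_mulAM x y : in_mulA x -> in_mulA (y * x).
Proof. by move=> [u ->]; exists (y * u); rewrite mulrCA. Qed.
Lemma in_mulAN x : in_mulA x -> in_mulA (- x).
Proof. by move=> [u ->]; exists (- u); rewrite mulrN. Qed.

(** Linear independence of the classes modulo [l] over the field with [l] elements. *)
Definition indep_mod s (b : 'I_s -> A) := forall c : 'I_s -> int,
  in_mulA (\sum_i (c i)%:~R * b i) -> forall i, (l %| c i)%Z.

(** Infinite descent: [l] divides the coefficients of a relation, and dividing by [l] gives another
    relation, so every power of [l] divides them. *)
Lemma indep_mod_free s (b : 'I_s -> A) (c : 'I_s -> int) :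
  indep_mod b -> \sum_i (c i)%:~R * b i = 0 -> forall i, c i = 0.
Proof.
move=> bind c0 i.
have dvd n : forall c : 'I_s -> int, \sum_i (c i)%:~R * b i = 0 -> ((l ^ n)%N %| c i)%Z.
  elim: n => [|n IH] d d0; first by rewrite expn0 dvd1z.
  have dl j : (l %| d j)%Z by apply: bind; exists 0; rewrite mulr0.
  have dE j : d j = (d j %/ l)%Z * l by rewrite divzK.
  rewrite dE expnSr PoszM dvdz_mul //; apply: (IH (fun j => (d j %/ l)%Z)).
  apply: (mulAI (natA_neq0 (prime_gt0 l_pr))); rewrite mulr0 -[RHS]d0 mulr_sumr.
  by apply: eq_bigr => j _; rewrite [in RHS]dE intrM mulrCA mulrA.
have := dvd `|c i|%N c c0; rewrite dvdzE /= => cl.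
apply/eqP; rewrite -absz_eq0; apply: contraLR cl => ci.
rewrite gtnNdvd //; first by lia.
by apply: ltn_expl; apply: prime_gt1.
Qed.

(** Clearing denominators turns a rational relation into an integral one. The bound guarantees a
    maximal independent family. *)
Lemma indep_mod_size s (b : 'I_s -> A) : indep_mod b -> (s <= \dim {:K})%N.
Proof.
move=> bind; pose X := [tuple int_val (b i) | i < s].
suff /eqP : free X by rewrite size_tuple => <-; apply: dimvS; apply: subvf.
apply/freeP => k k0 i; pose D := \prod_j denq (k j).
pose c i := numq (k i) * \prod_(j | j != i) denq (k j).
have cE j : (c j)%:~R = D%:~R * k j :> rat.
  by rewrite /c /D [in RHS](bigD1 j) //= !intrM numqE; ring.
suff /(_ i) ci : forall i, c i = 0.
  have : D%:~R * k i = 0 :> rat by rewrite -cE ci.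
  move=> /eqP; rewrite mulf_eq0 intr_eq0 => /orP[|/eqP //].
  by rewrite prodf_seq_eq0 => /hasP[j _]; rewrite denq_eq0.
apply: (indep_mod_free bind); apply: int_val_inj.
have -> : int_val (\sum_i (c i)%:~R * b i) = \sum_i (c i)%:~R * int_val (b i).
  transitivity (\sum_i int_val ((c i)%:~R * b i)); first exact: (raddf_sum (val : {additive A -> K})).
  apply: eq_bigr => j _.
  by rewrite int_valM int_valz.
transitivity (D%:~R *: \sum_i k i *: X`_i); last by rewrite k0 scaler0.
rewrite scaler_sumr; apply: eq_bigr => j _.
by rewrite scalerA -cE scaler_int mulrzl -tnth_nth tnth_mktuple.
Qed.

(* Elements that are independent modulo l are free over the rationals. *)
Lemma finite_mod : exists (T : finType) (r : T -> A), forall a, exists t, in_mulA (a - r t).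
Proof.
pose P s := `[< exists b : 'I_s -> A, indep_mod b >].
have P0 : exists s, P s by exists 0%N; apply/asboolP; exists (fun _ => 0) => c _ [].
have Ple s : P s -> (s <= \dim {:K})%N by move=> /asboolP[b]; apply: indep_mod_size.
case: (ex_maxnP P0 Ple) => s /asboolP[b bind] smax.
exists {ffun 'I_s -> 'I_l}, (fun t : {ffun 'I_s -> 'I_l} => \sum_i (t i : nat)%:R * b i) => a.
pose b' (i : 'I_s.+1) := if unlift ord_max i is Some j then b j else a.
(* By maximality of [s], appending [a] to [b] destroys independence. *)
have /existsNP[c /not_implyP[cl /existsNP[i0 ci0]]] : ~ indep_mod b'.
  move=> b'ind; suff: (s < s)%N by rewrite ltnn.
  by apply/smax/asboolP; exists b'.
rewrite big_ord_recr /= {2}/b' unlift_none in cl.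
have {}cl : in_mulA (\sum_(i < s) (c (widen_ord (leqnSn s) i))%:~R * b i + (c ord_max)%:~R * a).
  move: cl; congr (in_mulA (_ + _)); apply: eq_bigr => i _; congr (_ * _).
  rewrite /b'; have -> : widen_ord (leqnSn s) i = lift ord_max i.
    by apply: val_inj; rewrite /= /bump leqNgt ltn_ord.
  by rewrite liftK.
(* If [l] divided the coefficient of [a], the relation would be one among the [b i], and [l] would
   divide all its coefficients. *)
have lc : ~~ (l %| c ord_max)%Z.
  apply/negP => lc; case: ci0.
  have ld : forall i : 'I_s, (l %| c (widen_ord (leqnSn s) i))%Z.
    apply: bind; have := in_mulAD cl (in_mulAN (in_mulAM a _ : in_mulA (a * (c ord_max)%:~R))).
    rewrite [a * _]mulrC addrK; apply.
    by exists ((c ord_max %/ l)%Z)%:~R; rewrite -{1}(divzK lc) intrM mulrC.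
  case: (unliftP ord_max i0) => [j ->|-> //]; move: (ld j).
  by congr (is_true (_ %| c _)%Z); apply: val_inj; rewrite /= /bump leqNgt ltn_ord.
(* Inverting this coefficient modulo [l] solves the relation for [a]; the resulting coefficients
   [e i] are then reduced to residues below [l]. *)
have [d [m dm]] : exists d m : int, d * c ord_max = 1 + m * l.
  have : coprimez (c ord_max) l.
    rewrite coprimezE /= coprime_sym prime_coprime //.
  move=> /coprimezP[[u v] /= uv]; exists u, (- v); lia.
pose e i := - d * c (widen_ord (leqnSn s) i).
have l0 : (l : int) != 0 by have := prime_gt0 l_pr; lia.
have elt i : (`|(e i %% l)%Z| < l)%N.
  have := modz_ge0 (e i) l0; have := ltz_pmod (e i) (_ : 0 < l :> int).
  have := prime_gt0 l_pr; lia.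
exists [ffun i => Ordinal (elt i)].
have eE i : exists f : int, e i = (`|(e i %% l)%Z|%N : int) + f * l.
  exists (e i %/ l)%Z; have := divz_eq (e i) l; have := modz_ge0 (e i) l0; lia.
have [f fE] := choice eE.
have -> : \sum_i ([ffun i => Ordinal (elt i)] i : nat)%:R * b i =
   \sum_i (e i)%:~R * b i - l%:R * \sum_i (f i)%:~R * b i.
  rewrite mulr_sumr -sumrB; apply: eq_bigr => i _; rewrite ffunE /=.
  by rewrite {2}fE intrD intrM -!pmulrn; ring.
rewrite opprB addrCA addrC; apply: in_mulAD; last first.
  by exists (\sum_i (f i)%:~R * b i).
have -> : a = d%:~R * (c ord_max)%:~R * a - l%:R * (m%:~R * a).
  by rewrite -intrM dm intrD intrM -pmulrn; ring.
have -> : \sum_i (e i)%:~R * b i =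
    - d%:~R * \sum_(i < s) (c (widen_ord (leqnSn s) i))%:~R * b i.
  by rewrite mulr_sumr; apply: eq_bigr => i _; rewrite /e intrM intrN mulrA.
rewrite mulNr opprK addrAC -mulrA -mulrDr; apply: in_mulAD.
  by apply: in_mulAM; rewrite addrC.
by apply: in_mulAN; exists (m%:~R * a).
Qed.

Lemma pigeonhole_mod (f : nat -> A) : exists i j, (i < j)%N /\ in_mulA (f i - f j).
Proof.
have [T [r rP]] := finite_mod; have [t tP] := choice (fun n => rP (f n)).
have [i [j [ij tij]]] := not_inj_nat t; exists i, j; split=> //.
have := in_mulAD (tP i) (in_mulAN (tP j)); rewrite tij.
by rewrite opprB addrA subrK.
Qed.
End ModPrime.
End RingOfIntegers.

(* A copy of T on which the finiteness proof yields a finType structure. *)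
Definition fin_of (T : choiceType) (Tfin : finite_set [set: T]) : Type := T.

Section FinOf.
Variables (T : choiceType) (Tfin : finite_set [set: T]).
Local Notation F := (fin_of Tfin).

HB.instance Definition _ := Choice.copy F T.

Let s : seq F := enum_fset (fset_set [set: T]).

Fact fin_of_mem (x : F) : x \in s.
Proof. by have := in_fset_set Tfin (x : T); rewrite in_setT. Qed.

Fact fin_of_pickleK : pcancel (fun x : F => index x s) (onth s).
Proof.
move=> x; have := fin_of_mem x; rewrite -index_mem -onthTE.
case sx: (onth s _) => [y|] // _; congr Some.
by rewrite -(@onth_nth _ x _ _ _ sx) nth_index // fin_of_mem.
Qed.

HB.instance Definition _ := Choice_isCountable.Build F fin_of_pickleK.

Fact fin_of_enumP : Finite.axiom s.
Proof. by move=> x; rewrite (@count_uniq_mem F) ?(fin_of_mem x) ?(fset_uniq (fset_set [set: T])). Qed.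

HB.instance Definition _ := fintype.isFinite.Build F fin_of_enumP.
End FinOf.

HB.instance Definition _ (A : comNzRingType) (Afin : finite_set [set: A]) :=
  GRing.ComNzRing.copy (fin_of Afin) A.


Lemma ncard_imset (T : finType) (U : choiceType) (S : {set T}) (f : T -> U) :
  {in S &, injective f} -> ncard [set f x | x in [set` S]] = #|S|.
Proof.
move=> finj; rewrite /ncard fset_set_image //.
rewrite card_in_imfset => [|x y]; last by rewrite !in_fset_set // !inE; exact: finj.
rewrite (_ : fset_set [set` S] = [fset x in enum S]%fset).
  rewrite card_fseq undup_id ?enum_uniq // -cardE.
  by apply: eq_card => x.
apply/fsetP => x; rewrite in_fset_set // !inE; apply/idP/idP.
  by rewrite inE /= => xS; rewrite mem_enum.
by rewrite mem_enum => xS; rewrite inE.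
Qed.

Lemma ncard_fin_of (T : choiceType) (Tfin : finite_set [set: T]) :
  ncard [set: T] = #|{: fin_of Tfin}|.
Proof.
rewrite -cardsT -(@ncard_imset (fin_of Tfin) T [set: fin_of Tfin]%SET id) //.
congr ncard; apply/seteqP; split=> x _; last by []. by exists x => //; rewrite /= inE.
Qed.

(** * Residue field, local uniformizer and quotients by powers of p *)

Section PrimeIdeal.
Variables (K : fieldExtType rat) (p : prime_idealr (ring_of_integers K)).
Local Notation A := (ring_of_integers K).
Hypothesis p_neq0 : exists2 x : A, x \in p & x != 0.

(** Expansion in base [l], with the representatives of [finite_mod] as digits. *)
Lemma powers_finite_mod (l : nat) n : prime l ->
  exists (T : finType) (r : T -> A), forall a, exists t y, a = r t + l%:R ^+ n * y.
Proof.
move=> l_pr; have [T [r rP]] := @finite_mod K _ l_pr.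
elim: n => [|n [S [r' r'P]]].
  by exists unit, (fun _ => 0) => a; exists tt, a; rewrite add0r mul1r.
exists (S * T)%type, (fun st => r' st.1 + l%:R ^+ n * r st.2) => a.
have [s [y ->]] := r'P a; have [t [z yz]] := rP y.
exists (s, t), z; rewrite -[y](subrK (r t)) yz /= exprS; ring.
Qed.

Lemma prime_ideal_powerP (x : A) j : x \in p -> ideal_exp p j (x ^+ j).
Proof.
move=> xp; elim: j => [//|j IH]; exists [:: (x, x ^+ j)].
  by move=> ab; rewrite inE => /eqP->.
by rewrite big_seq1 exprS.
Qed.

Lemma prime_expr (x : A) j : x ^+ j \in p -> x \in p.
Proof.
elim: j => [|j IH]; first by rewrite idealr1.
by rewrite exprS prime_idealrM => /orP[].
Qed.

(** Two powers x^i and x^j agree modulo l, hence modulo p; cancelling x^i shows that x^(j - i - 1)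
    is an inverse. *)
Lemma prime_maximal (x : A) : x \notin p -> exists y, x * y - 1 \in p.
Proof.
move=> xp; have [l l_pr lp] := prime_nat_mem p_neq0.
have [i [j [ij [z xij]]]] := pigeonhole_mod l_pr (fun i => x ^+ i).
exists (x ^+ (j - i).-1); rewrite -exprS prednK ?subn_gt0 //.
have : x ^+ i * (x ^+ (j - i) - 1) \in p.
  rewrite mulrBr mulr1 -exprD subnKC; last exact: ltnW.
  by rewrite -opprB rpredN xij mulrC idealMr.
by rewrite prime_idealrM => /orP[/prime_expr|//]; rewrite (negbTE xp).
Qed.

(* b is built by multiplying in powers of the finitely many classes of p
   modulo l, which are nilpotent on the part of A / l A supported at p. *)
Lemma annihilator_mod (l : nat) : prime l -> l%:R \in p ->
  exists b : A, ~ in_mulA l b /\ forall y, y \in p -> in_mulA l (b * y).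
Proof.
move=> l_pr lp; have [T [r rP]] := @finite_mod K _ l_pr.
have in_lp x : in_mulA l x -> x \in p by move=> [y ->]; rewrite mulrC idealMr.
pose b0 := \prod_(t | r t \notin p) r t.
have b0p : b0 \notin p.
  apply: (big_ind (fun x => x \notin p)); first by rewrite idealr1.
    by move=> x y xp yp; rewrite prime_idealrM negb_or xp.
  by [].
(* The product of [y ^+ i] and [1 - y ^+ (j - i)] is divisible by [l], and the second factor lies
   outside [p], so it is congruent to one of the factors of [b0]. *)
have b0_nil y : y \in p -> exists n, in_mulA l (b0 * y ^+ n).
  move=> yp; have [i [j [ij yij]]] := pigeonhole_mod l_pr (fun i => y ^+ i).
  exists i; have ynp : 1 - y ^+ (j - i) \notin p.
    apply/negP => /(rpredD (_ : y ^+ (j - i) \in p)); rewrite addrC subrK idealr1.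
    have -> : (j - i = (j - i).-1.+1)%N by rewrite prednK ?subn_gt0.
    by rewrite exprSr idealMr // => /(_ isT).
  have [t ty] := rP (1 - y ^+ (j - i)).
  have rtp : r t \notin p.
    apply: contra ynp => rtp.
    by rewrite -[1 - _](subrK (r t)) rpredD // in_lp.
  rewrite /b0 (bigD1 t) //=; set c := \prod_(_ | _) _.
  have -> : r t * c * y ^+ i = c * (y ^+ i - y ^+ j) - c * y ^+ i * (1 - y ^+ (j - i) - r t).
    rewrite -{1}(subnKC (ltnW ij)) exprD; ring.
  by apply: in_mulAD; [apply: in_mulAM|apply/in_mulAN/in_mulAM].
have : exists b, [/\ ~ in_mulA l b, forall y, y \in p -> exists n, in_mulA l (b * y ^+ n) &
    forall t, t \in enum T -> r t \in p -> in_mulA l (b * r t)].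
  elim: (enum T) => [|t s [b [bl bnil bs]]].
    by exists b0; split=> // b0l; rewrite in_lp in b0p.
  have [rtp|rtp] := boolP (r t \in p); last first.
    exists b; split=> // t'; rewrite inE => /orP[/eqP->|/bs//].
    by rewrite (negbTE rtp).
  (* For the least such exponent, one power less gives a multiple of [b] that is not divisible by
     [l] but becomes so when multiplied by [r t]. *)
  have exn : exists n, `[< in_mulA l (b * r t ^+ n) >].
    by have [n ?] := bnil _ rtp; exists n; apply/asboolP.
  case: (ex_minnP exn) => -[|n] /asboolP bn nmin; first by rewrite mulr1 in bn.
  exists (b * r t ^+ n); split=> [/asboolP/nmin|y yp|t']; first by rewrite ltnn.
    have [m ym] := bnil _ yp; exists m.
    by rewrite mulrAC mulrC; apply: in_mulAM.
  rewrite inE => /orP[/eqP->|t's rp']; first by rewrite -mulrA -exprSr.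
  by rewrite mulrAC mulrC; apply/in_mulAM/bs.
move=> [b [bl _ br]]; exists b; split=> // y yp; have [t yt] := rP y.
have rtp : r t \in p.
  by rewrite -[r t]opprK -[- r t](addrK y) opprB rpredB // addrC in_lp.
rewrite -[y](subrK (r t)) mulrDr; apply: in_mulAD; first exact: in_mulAM.
by apply: br => //; rewrite mem_enum.
Qed.

(** These properties say that [pi] generates [p] after localization at [p]. With [b] from
    [annihilator_mod], the quotient b / l maps [p] into the ring without lying in it. If b y / l is
    outside [p] for some y in [p], then u = b y / l and pi = y work. *)
Lemma uniformizer_exists : exists u pi : A,
  [/\ u \notin p, pi \in p & forall y, y \in p -> exists c, u * y = pi * c].
Proof.
have [l l_pr lp] := prime_nat_mem p_neq0.
have [b [bl bp]] := annihilator_mod l_pr lp.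
have l0 : (l%:R : A) <> 0 := @natA_neq0 K _ (prime_gt0 l_pr).
have [[y [yp bnp]]|all_p] : (exists y, y \in p /\ forall z, z \in p -> b * y <> l%:R * z) \/
    (forall y, y \in p -> exists2 z, z \in p & b * y = l%:R * z).
  have [H|/forallNP H] := EM (exists y, y \in p /\ forall z, z \in p -> b * y <> l%:R * z).
    by left.
  right=> y yp; have /not_andP[//|/existsNP[z /not_implyP[zp /contrapT bz]]] := H y.
  by exists z.
  have [u byu] := bp y yp; exists u, y; split=> //.
    by apply/negP => /bnp.
  move=> z zp; have [c bzc] := bp z zp; exists c.
  apply: (mulAI l0); have -> : l%:R * (u * z) = l%:R * u * z by ring.
  rewrite -byu; have -> : b * y * z = y * (b * z) by ring.
  by rewrite bzc; ring.
(* Otherwise x = b / l satisfies x p <= p, so that the l x^k lie in A. *)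
exfalso; pose f y := if pselect (y \in p) is left yp then sval (cid2 (all_p y yp)) else 0.
have fp y : y \in p -> f y \in p /\ b * y = l%:R * f y.
  by rewrite /f; case: pselect => // yp _; case: cid2.
have ap k : iter k f l%:R \in p by elim: k => //= k /fp[].
pose x : K := int_val b / l%:R.
have l0K : l%:R != 0 :> K.
  by apply/eqP => l0K; apply: l0; apply: int_val_inj; rewrite int_valn.
have aE k : int_val (iter k f l%:R) = l%:R * x ^+ k.
  elim: k => [|k IH]; first by rewrite mulr1 int_valn.
  have [_ /(congr1 (@int_val K))] := fp _ (ap k).
  rewrite !int_valM int_valn IH /= => bx; apply: (mulfI l0K); rewrite -bx /x exprS.
  by field.
(* Two of the elements l x^k agree modulo l, so c = x^i - x^j is in the ring and x is a root of the
   monic polynomial X^j - X^i + c. *)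
have [i [j [ij [c aij]]]] := pigeonhole_mod l_pr (fun k => iter k f l%:R).
have xij : x ^+ i - x ^+ j = int_val c.
  apply: (mulfI l0K); rewrite mulrBr -!aE.
  by have := congr1 (@int_val K) aij; rewrite int_valM int_valn.
have xint : x \in @integral_pred K.
  apply/asboolP; pose P : {poly K} := 'X^j - ('X^i - (int_val c)%:P).
  have szi : (size ('X^i - (int_val c)%:P)%R <= j)%N.
    apply: leq_trans (size_polyD _ _) _; rewrite size_polyXn size_polyN geq_max ij.
    by rewrite (leq_trans (size_polyC_leq1 _)) //; lia.
  apply: (@integral_root_monic _ _ _ x P).
  - by rewrite monicE lead_coefDl ?lead_coefXn // size_polyXn size_polyN ltnS.
  - by rewrite rootE !hornerE -xij; apply/eqP; ring.
  - apply/integral_poly => n; rewrite coefB coefB !coefXn coefC.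
    apply: integral_sub; first exact: integral_nat.
    apply: integral_sub; first exact: integral_nat.
    by case: ifP => _; [apply/asboolP/int_valP | exact: (integral_nat _ 0)].
apply: bl; exists (RingOfIntegers xint).
by apply: int_val_inj; rewrite int_valM int_valn /= /x mulrCA mulfV ?mulr1.
Qed.

Section Uniformizer.
Variables (u pi : A).
Hypotheses (up : u \notin p) (pip : pi \in p)
  (upi : forall y, y \in p -> exists c, u * y = pi * c).

Lemma unif_neq0 : pi <> 0.
Proof.
move=> pi0; have [x xp /eqP x0] := p_neq0; have [c] := upi xp.
rewrite pi0 mul0r => /ring_of_integers_domain[u0|//].
by move: up; rewrite u0 idealr0.
Qed.

Lemma ideal_exp_unif j y : ideal_exp p j y -> exists c, u ^+ j * y = pi ^+ j * c.
Proof.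
elim: j y => [|j IH] y; first by exists y.
move=> [s sI ->]; elim: s sI => [|ab s IHs] sI.
  by exists 0; rewrite big_nil !mulr0.
have [|c cE] := IHs; first by move=> ab' abs; apply: sI; rewrite inE abs orbT.
have [/upi[d dE] /IH[f fE]] := sI ab (mem_head _ _).
exists (d * f + c); rewrite big_cons !mulrDr cE; congr (_ + _).
have -> : u ^+ j.+1 * (ab.1 * ab.2) = (u * ab.1) * (u ^+ j * ab.2) by rewrite exprS; ring.
by rewrite dE fE exprS; ring.
Qed.

Lemma inv_mod_power (x : A) j : x \notin p -> exists y, ideal_exp p j (x * y - 1).
Proof.
move=> xp; elim: j => [|j [y yj]]; first by exists 0.
have [y1 y1p] := prime_maximal xp.
(* Chosen so that [x] times it is 1 - (x y1 - 1)(x y - 1): the two errors multiply. *)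
exists (- (x * y * y1 - y - y1)); exists [:: (- (x * y1 - 1), x * y - 1)].
  by move=> ab; rewrite inE => /eqP-> /=; rewrite rpredN.
by rewrite big_seq1 /=; ring.
Qed.

(** The factor u^i of [ideal_exp_unif] is invertible modulo p^j, so p^i is generated by pi^i modulo
    p^j. *)
Lemma ideal_exp_principal i j y : ideal_exp p i y ->
  exists c, ideal_exp p j (y - pi ^+ i * c).
Proof.
move=> /ideal_exp_unif[c uc].
have [v vj] : exists v, ideal_exp p j (u ^+ i * v - 1).
  by apply: inv_mod_power; apply: contra up => /prime_expr.
exists (c * v); rewrite mulrA -uc.
have -> : y - u ^+ i * y * v = - y * (u ^+ i * v - 1) by ring.
exact: ideal_expM.
Qed.

(** In the domain, pi^i cancels from u^j pi^i c = pi^j d, and u^j is invertible modulo p^(j - i). *)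
Lemma unif_exp_cancel i j c : (i <= j)%N -> ideal_exp p j (pi ^+ i * c) ->
  ideal_exp p (j - i) c.
Proof.
move=> ij /ideal_exp_unif[d]; rewrite -{2}(subnKC ij) exprD mulrCA -mulrA => cd.
have {}cd : u ^+ j * c = pi ^+ (j - i) * d.
  apply: mulAI cd; have pi0 := unif_neq0.
  by elim: i {ij} => [|i IH]; [move/eqP; rewrite oner_eq0|rewrite exprS => /ring_of_integers_domain[]].
have [v vj] : exists v, ideal_exp p (j - i) (u ^+ j * v - 1).
  by apply: inv_mod_power; apply: contra up => /prime_expr.
have -> : c = v * (u ^+ j * c) + (- c) * (u ^+ j * v - 1) by ring.
apply: ideal_expD; last exact: ideal_expM.
rewrite cd mulrCA mulrC; apply: ideal_expM; exact: prime_ideal_powerP.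
Qed.

Lemma ideal_exp1 y : ideal_exp p 1 y -> y \in p.
Proof.
move=> [s sI ->]; rewrite big_seq; apply: rpred_sum => ab /sI[abp _].
by rewrite mulrC idealMr.
Qed.
End Uniformizer.

Lemma finite_quot_exp k : finite_set [set: {ideal_quot (ideal_expS p k)}].
Proof.
have [l l_pr lp] := prime_nat_mem p_neq0.
have [T [r rP]] := powers_finite_mod k.+1 l_pr.
apply: (sub_finite_set (B := range (fun t => \pi_{ideal_quot (ideal_expS p k)} (r t)))).
  move=> x _; have [t [y xE]] := rP (repr x); exists t => //.
  rewrite -[RHS]reprK xE rmorphD /=; apply/esym.
  apply/eqP; rewrite addrC -subr_eq0 addrK -(rmorph0 (\pi_{ideal_quot (ideal_expS p k)})).
  rewrite -Quotient.idealrBE subr0; apply/asboolP; rewrite mulrC.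
  exact/ideal_expM/prime_ideal_powerP.
exact: finite_image.
Qed.

Lemma finite_quot_prime : finite_set [set: {ideal_quot p}].
Proof.
apply: (sub_finite_set (B := range (fun x : {ideal_quot (ideal_expS p 0)} => \pi_{ideal_quot p} (repr x)))).
  move=> x _; exists (\pi_{ideal_quot (ideal_expS p 0)} (repr x)) => //.
  rewrite -[RHS]reprK; apply/eqP; rewrite -Quotient.idealrBE; apply: ideal_exp1.
  set z := repr (\pi _); suff /asboolP : z - repr x \in ideal_expS p 0 by [].
  by rewrite Quotient.idealrBE /z reprK.
exact/finite_image/finite_quot_exp.
Qed.

Local Notation Q k := {ideal_quot (ideal_expS p k)}.

Lemma quot_exp_chain k (Bfin := finite_quot_exp k) :
  exists pi : A, pi \in p /\
    chain_ring (\pi_(Q k) pi : fin_of Bfin) k.+1 (ncard [set: {ideal_quot p}]).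
Proof.
have [u [pi [up pip upi]]] := uniformizer_exists.
have piQ (x y : A) : (\pi_(Q k) x = \pi_(Q k) y) <-> ideal_exp p k.+1 (x - y).
  split=> [/eqP|xy]; first by rewrite -Quotient.idealrBE => /asboolP.
  by apply/eqP; rewrite -Quotient.idealrBE; apply/asboolP.
have pi0 (x : A) : (\pi_(Q k) x = 0) <-> ideal_exp p k.+1 x.
  by rewrite -[x in ideal_exp _ _ x]subr0 -piQ rmorph0.
have piX n : (\pi_(Q k) pi) ^+ n = \pi_(Q k) (pi ^+ n) by rewrite rmorphXn.
exists pi; split=> //; split=> //.
- rewrite /= piX; split; first exact/pi0/prime_ideal_powerP.
  rewrite [X in X != _]piX; apply/eqP => /pi0; rewrite -[pi ^+ k]mulr1.
  move=> /(unif_exp_cancel up pip upi (leqnSn k)); rewrite subSnn => /ideal_exp1.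
  by rewrite idealr1.
- move=> x; have [xp|xp] := boolP (repr (x : Q k) \in p); [right|left].
    have xp1 : ideal_exp p 1 (repr (x : Q k)) := prime_ideal_powerP 1 xp.
    have [c cE] := ideal_exp_principal up upi k.+1 xp1.
    exists (\pi_(Q k) c); rewrite -[LHS](reprK (x : Q k)); apply: etrans (rmorphM (\pi_(Q k)) pi c).
    exact/piQ.
  have [y yE] := inv_mod_power k.+1 xp; exists (\pi_(Q k) y).
  by rewrite -[x](reprK (x : Q k)); apply: etrans (esym (rmorphM (\pi_(Q k)) _ y)) (etrans _ (rmorph1 (\pi_(Q k)))); apply/piQ.
(* Multiplication by pi^k identifies the residue field with the socle. *)
- pose F := fin_of finite_quot_prime.
  pose f (a : F) : fin_of Bfin := \pi_(Q k) (pi ^+ k * repr (a : {ideal_quot p})).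
  rewrite (ncard_fin_of finite_quot_prime) -cardsT.
  have finj : injective f.
    move=> a b /piQ; rewrite -mulrBr => /(unif_exp_cancel up pip upi (leqnSn k)).
    rewrite subSnn => /ideal_exp1; rewrite Quotient.idealrBE => /eqP.
    by rewrite !reprK.
  rewrite -(card_imset _ finj); apply: eq_card => x; rewrite inE.
  apply/eqP/imsetP => [|[a _ ->]]; last first.
    apply: etrans (esym (rmorphM (\pi_(Q k)) _ _)) _; apply/pi0.
    by rewrite mulrA -exprS mulrC; apply/ideal_expM/prime_ideal_powerP.
  rewrite -[x](reprK (x : Q k)) => xE; have : \pi_(Q k) (pi * repr (x : Q k)) = 0.
    by rewrite rmorphM.
  move=> /pi0 /(unif_exp_cancel up pip upi (ltn0Sn k)); rewrite subn1 /= => xk.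
  have [c cE] := ideal_exp_principal up upi k.+1 xk.
  exists (\pi_{ideal_quot p} c : F) ; [exact: finset.in_setT|apply/piQ].
  set d := repr (\pi_{ideal_quot p} c); have dc : c - d \in p by rewrite Quotient.idealrBE /d reprK.
  have -> : repr (x : Q k) - pi ^+ k * d = (repr (x : Q k) - pi ^+ k * c) + pi ^+ k * (c - d) by ring.
  apply: ideal_expD => //; exists [:: (c - d, pi ^+ k)].
    by move=> ab; rewrite inE => /eqP->; split=> //; apply: prime_ideal_powerP.
  by rewrite big_seq1 mulrC.
Qed.
End PrimeIdeal.

Definition add_char (C : fieldType) (V : zmodType) (chi : V -> C) : Prop :=
  chi 0 = 1 /\ forall x y, chi (x + y) = chi x * chi y.

(** * Additive characters and intertwiners *)

Section AddChar.
Variable C : numClosedFieldType.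

Lemma add_char_neq0 (V : zmodType) (chi : V -> C) x : add_char chi -> chi x != 0.
Proof.
move=> [c0 cD]; apply: contra (oner_neq0 C) => /eqP cx.
by rewrite -c0 -(subrr x) cD cx mul0r.
Qed.

Lemma add_charN (V : zmodType) (chi : V -> C) x : add_char chi -> chi (- x) = (chi x)^-1.
Proof.
move=> cchi; have [c0 cD] := cchi; apply: (mulfI (add_char_neq0 x cchi)).
by rewrite -cD subrr c0 divff // add_char_neq0.
Qed.

Lemma add_char_sum0 (V : finZmodType) (chi : V -> C) s :
  add_char chi -> chi s != 1 -> \sum_x chi x = 0.
Proof.
move=> [c0 cD] cs; apply/eqP; have : (chi s - 1) * \sum_x chi x == 0.
  rewrite mulrBl mul1r subr_eq0 mulr_sumr [eqbRHS](reindex_inj (addrI s)).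
  by apply/eqP/eq_bigr => x _; rewrite cD.
by rewrite mulf_eq0 subr_eq0 (negbTE cs).
Qed.

Definition transl_mx (V : finZmodType) (b : V) : 'M[C]_#|V| :=
  \matrix_(i, j) (enum_val j == enum_val i + b)%:R.

Lemma transl_mxD (V : finZmodType) (b c : V) :
  transl_mx b *m transl_mx c = transl_mx (b + c).
Proof.
apply/matrixP => i j; rewrite !mxE (bigD1 (enum_rank (enum_val i + b))) //= !mxE enum_rankK eqxx mul1r.
rewrite big1 ?addr0 ?addrA // => k; rewrite !mxE => ki.
case: eqP => [ek|]; last by rewrite mul0r.
by case/eqP: ki; rewrite -ek enum_valK.
Qed.

(* A common eigenvector of the translations taken in the image of T s - T 0: if
   chi s were 1, summing its translates by multiples of s would telescope to 0. *)
Lemma add_char_sep (V : finZmodType) (s : V) : s != 0 ->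
  exists2 chi : V -> C, add_char chi & chi s != 1.
Proof.
move=> s0; pose T := @transl_mx V; pose X := T s - T 0.
have T0 : T 0 = 1%:M.
  by apply/matrixP => i j; rewrite !mxE addr0 (inj_eq enum_val_inj) eq_sym.
have X0 : X != 0.
  apply/eqP => /matrixP/(_ (enum_rank 0) (enum_rank 0)); rewrite !mxE !enum_rankK !add0r.
  by rewrite eqxx eq_sym (negbTE s0) sub0r => /eqP; rewrite oppr_eq0 oner_eq0.
have TD b c : T b *m T c = T (b + c) by apply: transl_mxD.
have TC b c : T b *m T c = T c *m T b by rewrite !TD addrC.
have [|w [c [v0 cv]]] := commuting_eigenvector TC _ X0.
  by move=> b; exists (T b); rewrite mulmxBr mulmxBl !(TC b).
have vI a b : a *: (X *m w) = b *: (X *m w) -> a = b.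
  by move=> /eqP; rewrite -subr_eq0 -scalerBl scaler_eq0 (negbTE v0) orbF subr_eq0 => /eqP.
have cD b b' : c (b + b') = c b * c b'.
  by apply: vI; rewrite -cv -TD -mulmxA cv -scalemxAr cv scalerA mulrC.
have c0 : c 0 = 1 by apply: vI; rewrite -cv T0 mul1mx scale1r.
exists c => //; apply/eqP => cs; have [i [j [ij sij]]] := not_inj_nat (fun n => s *+ n).
have sn : s *+ (j - i) = 0 by rewrite mulrnBr ?(ltnW ij) // sij subrr.
have cn n : c (s *+ n) = 1.
  by elim: n => [|n IH]; rewrite ?mulr0n // mulrS cD cs IH mulr1.
have : \sum_(0 <= n < (j - i)) T (s *+ n) *m (X *m w) = 0.
  transitivity ((\sum_(0 <= n < (j - i)) (T (s *+ n.+1) - T (s *+ n))) *m w).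
    rewrite mulmx_suml; apply: eq_bigr => n _; rewrite mulmxA mulmxBr !TD addr0.
    by rewrite -mulrSr.
  by rewrite telescope_sumr ?sn ?mulr0n ?subrr ?mul0mx.
rewrite (eq_bigr (fun _ => X *m w)); last by move=> n _; rewrite cv cn scale1r.
rewrite sumr_const_nat subn0 -scaler_nat => /eqP.
by rewrite scaler_eq0 (negbTE v0) orbF pnatr_eq0 subn_eq0 leqNgt ij.
Qed.

(* If chi is none of the chi0 (a * _), then the double sum of chi x * chi0 (- a x)
   vanishes by orthogonality in x, whereas orthogonality in a gives #|B|. *)
Lemma chain_ring_dual (B : finComNzRingType) (pi : B) (e q : nat) : chain_ring pi e q ->
  exists chi0 : B -> C, [/\ add_char chi0, forall a, a != 0 -> exists x, chi0 (a * x) != 1 &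
    forall chi, add_char chi -> exists a, forall x, chi x = chi0 (a * x)].
Proof.
move=> Bchain; have [_ [_ s0] _ _] := Bchain.
have [chi0 cchi0 c0s] := add_char_sep s0; exists chi0.
(* Every non-zero [a] has [pi ^+ e.-1] as a multiple, and [chi0] was chosen non-trivial there. *)
have nondeg a : a != 0 -> exists x, chi0 (a * x) != 1.
  move=> a0; have [u [j [aE [u' uu'] je]]] := chain_decomp Bchain a.
  have jlt : (j <= e.-1)%N.
    suff : (j != e)%N by have [e0 _ _ _] := Bchain; lia.
    by apply: contraNneq a0 => jeq; rewrite aE jeq; have [_ [-> _] _ _] := Bchain; rewrite mulr0.
  exists (u' * pi ^+ (e.-1 - j)); rewrite aE.
  have -> : u * pi ^+ j * (u' * pi ^+ (e.-1 - j)) = u * u' * (pi ^+ j * pi ^+ (e.-1 - j)) by ring.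
  by rewrite uu' mul1r -exprD subnKC.
split=> // chi cchi; apply: contrapT => /forallNP nchi.
have [c0 cD] := cchi; have [c00 c0D] := cchi0.
have : \sum_a \sum_x chi x * chi0 (- (a * x)) = 0.
  apply: big1 => a _; have /existsNP[s /eqP cs] := nchi a.
  apply: (@add_char_sum0 _ (fun x => chi x * chi0 (- (a * x))) s).
    split=> [|x y] /=; first by rewrite mulr0 oppr0 c0 c00 mulr1.
    by rewrite cD mulrDr opprD c0D; ring.
  rewrite add_charN // -(inj_eq (mulIf (add_char_neq0 (a * s) cchi0))) mul1r.
  by rewrite -mulrA mulVf ?mulr1 // add_char_neq0.
rewrite exchange_big /= (bigD1 0) //= [X in _ + X]big1 ?addr0 => [|x x0].
  rewrite (eq_bigr (fun _ => 1)); last by move=> a _; rewrite mulr0 oppr0 c0 c00 mulr1.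
  by rewrite sumr_const => /eqP; rewrite pnatr_eq0 => /eqP/card0_eq/(_ 0).
rewrite -mulr_sumr; have [a ca] := nondeg x x0.
rewrite (@add_char_sum0 _ (fun a => chi0 (- (a * x))) (- a)) ?mulr0 //; last first.
  by rewrite mulNr opprK mulrC.
by split=> [|b b'] /=; rewrite ?mul0r ?oppr0 // mulrDl opprD c0D.
Qed.
End AddChar.

Section Intertwining.
Variables (C : numClosedFieldType) (G : groupType).

Definition mx_hom d (rho : G -> 'M[C]_d) : Prop :=
  rho 1%g = 1%:M /\ forall g h, rho (g * h)%g = rho g *m rho h.

Lemma mx_homV d (rho : G -> 'M[C]_d) g : mx_hom rho -> rho g *m rho g^-1%g = 1%:M.
Proof. by move=> [r1 rM]; rewrite -rM mulgV r1. Qed.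

Lemma mx_homV' d (rho : G -> 'M[C]_d) g : mx_hom rho -> rho g^-1%g *m rho g = 1%:M.
Proof. by move=> [r1 rM]; rewrite -rM mulVg r1. Qed.

(* The operators X |-> rho g X sigma g^-1 commute, because the commutator
   scalars of rho and sigma cancel; a common eigenvector intertwines rho with a
   twist of sigma. *)
Lemma projective_intertwiner d d' (rho : G -> 'M[C]_d) (sigma : G -> 'M[C]_d')
    (c : G -> G -> C) :
  mx_hom rho -> mx_hom sigma -> irr_family rho -> irr_family sigma ->
  (forall g h, rho g *m rho h = c g h *: (rho h *m rho g)) ->
  (forall g h, sigma g *m sigma h = c g h *: (sigma h *m sigma g)) ->
  exists (X : 'M[C]_(d, d')) (chi : G -> C),
    [/\ exists Y, X *m Y = 1%:M, exists Y, Y *m X = 1%:M &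
        forall g, rho g *m X = chi g *: (X *m sigma g)].
Proof.
move=> hr hs ir is' rC sC; have [r1 rM] := hr; have [s1 sM] := hs.
(* [lin_mx] acts on rows; the transpose acts on columns, as [commuting_eigenvector] expects. *)
pose kappa g : 'M[C]_(d * d') := (lin_mx (mulmxr (sigma g^-1%g) \o mulmx (rho g)))^T.
have kE g X : kappa g *m (mxvec X)^T = (mxvec (rho g *m X *m sigma g^-1%g))^T.
  by rewrite -trmx_mul mul_vec_lin.
have d0 : (0 < d)%N by case: ir.
have d0' : (0 < d')%N by case: is'.
have cE g h : c g h *: sigma (h * g)%g = sigma (g * h)%g by rewrite !sM [RHS]sC.
have cV g h : sigma g^-1%g *m sigma h^-1%g = c g h *: (sigma h^-1%g *m sigma g^-1%g).
  rewrite -!sM -!invgM -[LHS]mul1mx -(mx_homV' (g * h)%g hs) -cE.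
  by rewrite -scalemxAr -scalemxAl -mulmxA mx_homV // mulmx1.
have kC g h : kappa g *m kappa h = kappa h *m kappa g.
  apply/matrixP => i j.
  have : kappa g *m kappa h *m delta_mx j (0 : 'I_1) = kappa h *m kappa g *m delta_mx j 0;
    last by move/colP/(_ i); rewrite -!colE !mxE.
  have [X ->] : exists X : 'M[C]_(d, d'), delta_mx j (0 : 'I_1) = (mxvec X)^T.
    by exists (vec_mx (delta_mx j 0)^T); rewrite vec_mxK trmxK.
  rewrite -!mulmxA !kE; congr (mxvec _)^T.
  transitivity ((rho g *m rho h) *m X *m (sigma h^-1%g *m sigma g^-1%g)).
    by rewrite !mulmxA.
  by rewrite rC -!scalemxAl scalemxAr -cV !mulmxA.
have [||w [chi [v0 chiE]]] := commuting_eigenvector kC (X := 1%:M).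
- by move=> g; exists (kappa g); rewrite mulmx1 mul1mx.
- apply/eqP => /matrixP/(_ (mxvec_index (Ordinal d0) (Ordinal d0')) (mxvec_index (Ordinal d0) (Ordinal d0'))).
  by rewrite !mxE eqxx => /eqP; rewrite oner_eq0.
rewrite mul1mx in v0 chiE; pose X : 'M[C]_(d, d') := vec_mx w^T.
have wX : w = (mxvec X)^T by rewrite vec_mxK trmxK.
have X0 : X != 0 by apply: contraNneq v0 => X0; rewrite wX X0 linear0 trmx0.
have XE g : rho g *m X = chi g *: (X *m sigma g).
  have := chiE g; rewrite wX kE -linearZ -linearZ /=.
  move=> /trmx_inj/(can_inj mxvecK) rX.
  by rewrite scalemxAl -rX -!mulmxA mx_homV' // mulmx1.
have chi0 g : chi g != 0.
  apply: contraNneq X0 => cg; have := XE g; rewrite cg scale0r => /(congr1 (mulmx (rho g^-1%g))).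
  by rewrite mulmxA mx_homV' // mul1mx mulmx0 => ->.
exists X, chi; split=> //.
  by apply: (irr_coker (s := fun g => chi g *: sigma g) ir) => // g; rewrite XE scalemxAr.
apply: (irr_ker (s := fun g => (chi g)^-1 *: rho g) is') => // g.
by rewrite -scalemxAl XE scalerA mulVf // scale1r.
Qed.
End Intertwining.

(** * The group Q_{1,1} *)

Section Coordinates.
Variable R : comPzRingType.
Local Notation row := 'rV[R]_(2 * 1 + 2 * 1).
Local Notation Z := (Zspan 1 1 R).

Definition idx0 : 'I_(2 * 1) := @Ordinal (2 * 1) 0 isT.
Definition idx1 : 'I_(2 * 1) := @Ordinal (2 * 1) 1 isT.

Definition lpart (u : row) (i : 'I_(2 * 1)) : R := u 0 (lshift (2 * 1) i).
Definition rpart (u : row) (i : 'I_(2 * 1)) : R := u 0 (rshift (2 * 1) i).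

Lemma sum_ord2 (V : nmodType) (F : 'I_(2 * 1) -> V) : \sum_i F i = F idx0 + F idx1.
Proof.
rewrite !big_ord_recl big_ord0 addr0.
by congr (F _ + F _); apply: val_inj.
Qed.

Lemma ord2P (P : 'I_(2 * 1) -> Prop) : P idx0 -> P idx1 -> forall i, P i.
Proof.
move=> P0 P1 [[|[|//]] lt]; first by rewrite (_ : Ordinal lt = idx0) //; apply: val_inj.
by rewrite (_ : Ordinal lt = idx1) //; apply: val_inj.
Qed.

(** The condition a < b in the cocycle keeps only the block of the y_ij and the entry 1 of J. *)
Lemma QcocycleE (u v : row) :
  Qcocycle u v = (lpart u idx0 * lpart v idx1, \matrix_(i, j) (lpart u i * rpart v j)).
Proof.
have bul i j : bracket_x R (lshift _ i) (lshift _ j) = Zy 1 1 R *~ J_mx 1 i j.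
  by rewrite /bracket_x /commutator_mx block_mxEul mxE.
have bur (i j : 'I_(2 * 1)) : bracket_x R (lshift _ i) (rshift _ j) = Zyij R i j.
  by rewrite /bracket_x /commutator_mx block_mxEur mxE.
have bdr (i j : 'I_(2 * 1)) : bracket_x R (rshift _ i) (rshift _ j) = 0.
  by rewrite /bracket_x /commutator_mx block_mxEdr mxE.
rewrite /Qcocycle big_split_ord /= [X in _ + X]big1 ?addr0; last first.
  move=> i _; apply: big1 => j ij; move: ij; case: (split_ordP j) => k -> /=.
    by move: (ltn_ord k) => ? ?; lia.
  by rewrite bdr scaler0.
rewrite (eq_bigr (fun i : 'I_(2 * 1) => \sum_(j < 2 * 1 | (i < j)%N) (lpart u i * lpart v j) *: (Zy 1 1 R *~ J_mx 1 i j) +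
   \sum_(j < 2 * 1) (lpart u i * rpart v j) *: Zyij R i j)); last first.
  move=> i _; rewrite big_split_ord /=; congr (_ + _).
    by apply: eq_bigr => j _; rewrite bul.
  apply: eq_big => j; first by move: (ltn_ord i) => ? /=; lia.
  by rewrite bur.
rewrite big_split /= (_ : \sum_(i < 2 * 1) \sum_(j < 2 * 1 | _) _ = (lpart u idx0 * lpart v idx1, 0)); last first.
  rewrite sum_ord2 [X in _ + X]big1 ?addr0; last first.
    by move=> j; elim/ord2P: j.
  rewrite big_mkcond sum_ord2 /= add0r mxE /=.
  by rewrite mulr1z; congr pair; [exact: mulr1|exact: scaler0].
rewrite !sum_ord2.
apply/pair_equal_spec; split=> /=; first by rewrite /GRing.scale /= !mulr0 !addr0.
by apply/matrixP => i j; rewrite !mxE; elim/ord2P: i; elim/ord2P: j; rewrite /= ?mulr1 ?mulr0 ?addr0 ?add0r.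
Qed.
End Coordinates.

Section Commutators.
Variables (R : comPzRingType) (C : numClosedFieldType).
Local Notation G := (Qgroup 1 1 R).
Local Notation Z := (Zspan 1 1 R).

Definition Qcomm (u v : 'rV[R]_(2 * 1 + 2 * 1)) : Z := Qcocycle u v - Qcocycle v u.

Lemma QmulE (g h : G) : (g * h)%g = Qmul g h. Proof. by []. Qed.

Lemma Qmul_central (u : 'rV[R]_(2 * 1 + 2 * 1)) (z : Z) :
  (u, z) = (((u, 0) : G) * ((0, z) : G))%g :> G.
Proof. by rewrite QmulE /Qmul /= addr0 add0r Qcocycle0r addr0. Qed.

Lemma Qmul_comm (g h : G) : (g * h)%g = (h * g * ((0, Qcomm g.1 h.1) : G))%g.
Proof.
have E (a b x y : Z) : a + b + x = b + a + y + (x - y).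
  by rewrite (addrC b) -[RHS]addrA (addrC y) subrK.
by rewrite !QmulE /Qmul /= Qcocycle0r !addr0; congr pair; [exact: addrC|exact: E].
Qed.

Definition central_char d (rho : G -> 'M[C]_d) (psi : Z -> C) : Prop :=
  forall z, rho (0, z) = (psi z)%:M.

Lemma central_char_comm d (rho : G -> 'M[C]_d) psi g h : mx_hom rho ->
  central_char rho psi -> rho g *m rho h = psi (Qcomm g.1 h.1) *: (rho h *m rho g).
Proof.
move=> [_ rM] rz; rewrite -!rM Qmul_comm [LHS]rM rz.
by rewrite mul_mx_scalar.
Qed.

Lemma irr_central_char d (rho : G -> 'M[C]_d) : mx_hom rho -> irr_family rho ->
  exists psi, central_char rho psi /\ add_char psi.
Proof.
move=> hr ir; have [r1 rM] := hr; have [d0 _] := ir.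
have zc (z : Z) : exists a, rho (0, z) = a%:M.
  apply: (schur_scalar ir) => g; rewrite -!rM; congr rho.
  by rewrite !QmulE /Qmul /= Qcocycle0l Qcocycle0r !addr0 add0r [in RHS]addrC.
have [psi rz] := choice zc; exists psi; split=> //.
have inj a b : a%:M = b%:M :> 'M[C]_d -> a = b.
  by move=> /matrixP/(_ (Ordinal d0) (Ordinal d0)); rewrite !mxE eqxx.
split; first by apply: inj; rewrite -rz -r1.
move=> x y; apply: inj; rewrite -rz scalar_mxM -!rz -rM; congr rho.
by rewrite QmulE /Qmul /= Qcocycle0l !addr0.
Qed.
End Commutators.

(** * Irreducible representations over a finite ring with given central character *)

Section FiniteQgroup.
Variables (B : finComNzRingType) (C : numClosedFieldType).
Local Notation row := 'rV[B]_(2 * 1 + 2 * 1).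
Local Notation G := (Qgroup 1 1 B).
Local Notation Z := (Zspan 1 1 B).
Variables (psi : Z -> C).
Hypothesis cpsi : add_char psi.

Let psi0 : psi 0 = 1. Proof. by case: cpsi. Qed.
Let psiD x y : psi (x + y) = psi x * psi y. Proof. by case: cpsi. Qed.

(* The representation induced from the character psi of the centre. *)
Definition ind_mx (g : G) : 'M[C]_#|{: row}| :=
  \matrix_(i, j) (psi (g.2 + Qcocycle (enum_val i) g.1) *+ (enum_val j == enum_val i + g.1)).

Lemma ind_mx_hom : mx_hom ind_mx.
Proof.
split=> [|g h].
  apply/matrixP => i j; rewrite !mxE /= Qcocycle0r !addr0 psi0.
  by rewrite (inj_eq enum_val_inj) eq_sym.
apply/matrixP => i j; rewrite !mxE (bigD1 (enum_rank (enum_val i + g.1))) //=.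
rewrite !mxE enum_rankK eqxx mulr1n big1 ?addr0 => [|k]; last first.
  rewrite !mxE => ki; case: eqP => [ek|]; last by rewrite mulr0n mul0r.
  by case/eqP: ki; rewrite -ek enum_valK.
rewrite addrA mulrnAr -psiD; congr (psi _ *+ _).
have E (x y c1 c2 c3 : Z) : x + y + c1 + (c2 + c3) = x + c2 + (y + (c3 + c1)).
  by rewrite (addrC c3) (addrA y) -(addrA x) addrACA.
by rewrite QcocycleDl QcocycleDr; apply: E.
Qed.

Lemma irr_rep_exists : exists d (rho : G -> 'M[C]_d),
  [/\ irr_family rho, mx_hom rho & central_char rho psi].
Proof.
have [t1 tM] := ind_mx_hom.
have card0 : (0 < #|{: row}|)%N by apply/card_gt0P; exists 0.
have [d [rho [P [irho [P' P'P] tP]]]] := irr_sub ind_mx card0.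
have rE g : rho g = P' *m (ind_mx g *m P) by rewrite tP mulmxA P'P mul1mx.
exists d, rho; split=> //.
  split=> [|g h]; first by rewrite rE t1 mul1mx.
  by rewrite rE tM -(mulmxA (ind_mx g)) tP (mulmxA (ind_mx g)) tP !mulmxA P'P mul1mx.
move=> z; rewrite rE; have -> : ind_mx (0, z) = (psi z)%:M.
  apply/matrixP => i j; rewrite !mxE /= Qcocycle0r !addr0.
  by rewrite (inj_eq enum_val_inj) eq_sym.
by rewrite mul_scalar_mx -scalemxAr P'P scalemx1.
Qed.

(** The radical of the alternating pairing psi [v, u], that is the row part of the centre of the
    group modulo the kernel of [psi]. *)
Definition radical : {set row} := [set u : row | [forall v, psi (Qcomm v u) == 1]]%SET.

Variables (d : nat) (rho : G -> 'M[C]_d).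
Hypotheses (hr : mx_hom rho) (ir : irr_family rho) (rz : central_char rho psi).

Let sg (u : row) := rho (u, 0).
Let tu (u : row) := rho ((u, 0) : G)^-1%g.

Lemma section_mul u v : sg u *m sg v = psi (Qcocycle u v) *: sg (u + v).
Proof.
have [_ rM] := hr; rewrite -rM -mul_mx_scalar -rz -rM; congr rho.
by rewrite !QmulE /Qmul /= !addr0 !add0r Qcocycle0r addr0.
Qed.

(** [sg] is multiplicative only up to scalars, but these cancel in a conjugation, so the additive
    group of rows acts on matrices. *)
Lemma section_conj (X : 'M[C]_d) u v :
  sg v *m (sg u *m X *m tu u) *m tu v = sg (v + u) *m X *m tu (v + u).
Proof.
have [r1 rM] := hr; have -> : sg v *m (sg u *m X *m tu u) *m tu v =
  (sg v *m sg u) *m X *m (tu u *m tu v) by rewrite !mulmxA.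
have c0 := add_char_neq0 (Qcocycle v u) cpsi.
suff -> : tu u *m tu v = (psi (Qcocycle v u))^-1 *: tu (v + u).
  by rewrite section_mul -!scalemxAl -!scalemxAr scalerA divff // scale1r.
apply: (can_inj (scalerK c0)); rewrite scalerA divff // scale1r.
rewrite -[LHS]mulmx1 -(mx_homV (((v + u : row), 0) : G) hr) -/(sg _) -/(tu _) mulmxA.
rewrite -scalemxAl -[RHS]mul1mx; congr (_ *m _).
rewrite scalemxAr -section_mul /tu -rM -invgM /sg -!rM.
by rewrite mulVg.
Qed.

(** Conjugation by a suitable [sg v] preserves the trace but multiplies [sg u] by a scalar other
    than 1. *)
Lemma section_trace u : u \notin radical -> \tr (sg u) = 0.
Proof.
rewrite inE negb_forall => /existsP[v pv].
have := central_char_comm (v, 0) (u, 0) hr rz; rewrite /= -/(sg _) -/(sg _) => /(congr1 (mulmxr (tu v))).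
rewrite /= -scalemxAl -(mulmxA (sg u)) (mx_homV _ hr) mulmx1 => /(congr1 mxtrace).
rewrite mxtraceZ mxtrace_mulC mulmxA (mx_homV' _ hr) mul1mx => /eqP.
by rewrite -subr_eq0 -{1}[\tr _]mul1r -mulrBl mulf_eq0 subr_eq0 eq_sym (negbTE pv) => /eqP.
Qed.

Lemma section_radical u : u \in radical -> \tr (sg u) * \tr (tu u) = d%:R ^+ 2.
Proof.
rewrite inE => /forallP ru.
have [a aE] : exists a, sg u = a%:M.
  apply: (schur_scalar ir) => g; rewrite (central_char_comm _ _ hr rz) /=.
  by rewrite (eqP (ru g.1)) scale1r.
have [d0 _] := ir.
have st : sg u *m tu u = 1%:M := mx_homV ((u, 0) : G) hr.
have a0 : a != 0.
  apply: contraTneq (oner_neq0 C) => a0; move: st; rewrite aE a0 mul_scalar_mx scale0r => /matrixP/(_ (Ordinal d0) (Ordinal d0)).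
  by rewrite !mxE eqxx => /eqP; rewrite eq_sym => ->.
have tE : tu u = (a^-1)%:M.
  apply: (can_inj (scalerK a0)); rewrite scale_scalar_mx divff //.
  by rewrite -mul_scalar_mx -aE.
by rewrite aE tE !mxtrace_scalar -(mulr_natr a) -(mulr_natr a^-1) mulrACA divff // mul1r.
Qed.

(* By Schur, averaging over the group gives scalars; the sum of the entries (i, j)
   of the averages of delta_mx i j is then evaluated by traces, which vanish
   outside the radical. *)
Lemma dim_radical : (d ^ 2 * #|radical| = #|B| ^ 4)%N.
Proof.
have [d0 _] := ir; have d0' : d%:R != 0 :> C by rewrite pnatr_eq0 -lt0n.
pose avg X := \sum_u sg u *m X *m tu u.
have avgC X g : rho g *m avg X = avg X *m rho g.
  have vC v : sg v *m avg X = avg X *m sg v.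
    have : sg v *m avg X *m tu v = avg X.
      rewrite mulmx_sumr mulmx_suml (eq_bigr _ (fun u _ => section_conj X u v)).
      by rewrite [RHS](reindex_inj (addrI v)).
    by move=> /(congr1 (mulmxr (sg v))) /=; rewrite -mulmxA mx_homV' // mulmx1.
  case: g => v z; rewrite Qmul_central; have [_ rM] := hr.
  by rewrite rM rz mul_mx_scalar -/(sg v) -scalemxAl vC scalemxAr.
have avgS X : avg X = (#|{: row}|%:R * \tr X / d%:R)%:M.
  have [a aE] := schur_scalar ir (avgC X); rewrite aE; congr (_%:M).
  apply: (mulIf d0'); rewrite mulfVK //.
  transitivity (\tr (avg X)); first by rewrite aE mxtrace_scalar mulr_natr.
  rewrite /avg raddf_sum (eq_bigr (fun _ => \tr X)) /=.
    by rewrite sumr_const mulr_natl.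
  by move=> u _; rewrite mxtrace_mulC mulmxA mx_homV' // mul1mx.
have trE (i j : 'I_d) : \tr (delta_mx i j : 'M[C]_d) = (i == j)%:R.
  rewrite /mxtrace (bigD1 i) //= big1 ?addr0 => [|k ki]; rewrite !mxE ?eqxx //.
  by rewrite (negbTE ki).
have : \sum_i \sum_j avg (delta_mx i j) i j = #|{: row}|%:R.
  transitivity (\sum_(i < d) #|{: row}|%:R / d%:R : C); last first.
    by rewrite sumr_const card_ord -(mulr_natr (_ / _)) mulfVK.
  apply: eq_bigr => i _; rewrite (bigD1 i) //= big1 ?addr0 => [|j ji].
    by rewrite avgS mxE eqxx trE eqxx mulr1.
  by rewrite avgS mxE eq_sym (negbTE ji).
have -> : \sum_i \sum_j avg (delta_mx i j) i j = \sum_u \tr (sg u) * \tr (tu u).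
  transitivity (\sum_i \sum_j \sum_u sg u i i * tu u j j).
    apply: eq_bigr => i _; apply: eq_bigr => j _; rewrite summxE; apply: eq_bigr => u _.
    rewrite mxE (bigD1 j) //= big1 ?addr0 => [|k kj]; rewrite mxE (bigD1 i) //= big1 ?addr0 ?mxE ?eqxx ?mulr1 //.
    - by move=> l li; rewrite mxE (negbTE li) mulr0.
    - by rewrite (negbTE kj) andbF mulr0 mul0r.
    - by move=> l li; rewrite mxE (negbTE li) mulr0.
  under eq_bigr => i _ do rewrite exchange_big /=.
  rewrite exchange_big /=; apply: eq_bigr => u _; rewrite /mxtrace mulr_suml.
  by apply: eq_bigr => i _; rewrite mulr_sumr.
rewrite (bigID (mem radical)) /= [X in _ + X]big1 ?addr0; last first.
  by move=> u nu; rewrite section_trace // mul0r.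
rewrite (eq_bigr _ (fun u (ru : u \in radical) => section_radical ru)) sumr_const.
rewrite card_mx -(mulr_natr (_ ^+ 2)) -natrX -natrM => /eqP; rewrite eqr_nat => /eqP.
by rewrite mul1n.
Qed.
End FiniteQgroup.

(** * Coordinates and linear forms on the centre *)

Section MkCoordinates.
Variable B : comPzRingType.
Local Notation row := 'rV[B]_(2 * 1 + 2 * 1).
Local Notation Z := (Zspan 1 1 B).

Definition mk_Z (t t00 t01 t10 t11 : B) : Z :=
  (t, \matrix_(i, j)
        if i == idx0 then if j == idx0 then t00 else t01
        else if j == idx0 then t10 else t11).

Lemma mk_ZE (z : Z) : z = mk_Z z.1 (z.2 idx0 idx0) (z.2 idx0 idx1) (z.2 idx1 idx0) (z.2 idx1 idx1).
Proof.
case: z => t A; congr pair; apply/matrixP => i j; rewrite mxE.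
by elim/ord2P: i; elim/ord2P: j.
Qed.

Definition mk_row (b : B * B * B * B) : row :=
  row_mx (\row_j if j == idx0 then b.1.1.1 else b.1.1.2) (\row_j if j == idx0 then b.1.2 else b.2).

Definition row_coord (u : row) : B * B * B * B :=
  (lpart u idx0, lpart u idx1, rpart u idx0, rpart u idx1).

Lemma mk_rowK : cancel mk_row row_coord.
Proof.
by move=> [[[b1 b2] b3] b4]; rewrite /row_coord /lpart /rpart !row_mxEl !row_mxEr !mxE.
Qed.

Lemma row_coordK : cancel row_coord mk_row.
Proof.
move=> u; apply/rowP => j; rewrite /mk_row /row_coord /=.
case: (split_ordP j) => i ->; rewrite ?row_mxEl ?row_mxEr !mxE; elim/ord2P: i => //=.
Qed.

End MkCoordinates.

Arguments row_coord {B} u.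
Arguments mk_row {B} b.

(* (a, ((w, x), (y, z))) lists the coefficients of a linear form on the centre at
   y, y_11, y_12, y_21 and y_22. *)
Definition zform (B : Type) : Type := (B * ((B * B) * (B * B)))%type.

Definition form_eval (B : comPzRingType) (s : zform B) (z : Zspan 1 1 B) : B :=
  s.1 * z.1 + (s.2.1.1 * z.2 idx0 idx0 + s.2.1.2 * z.2 idx0 idx1 +
               (s.2.2.1 * z.2 idx1 idx0 + s.2.2.2 * z.2 idx1 idx1)).

Lemma form_evalD (B : comPzRingType) (s : zform B) z z' :
  form_eval s (z + z') = form_eval s z + form_eval s z'.
Proof. by rewrite /form_eval /= !mxE; ring. Qed.

Section Forms.
Variables (B : finComNzRingType) (C : numClosedFieldType) (chi0 : B -> C).
Hypothesis cchi0 : add_char chi0.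
Hypothesis nondeg : forall a, a != 0 -> exists x, chi0 (a * x) != 1.
Hypothesis dual : forall chi, add_char chi -> exists a, forall x, chi x = chi0 (a * x).
Local Notation row := 'rV[B]_(2 * 1 + 2 * 1).
Local Notation Z := (Zspan 1 1 B).

Definition form_char (s : zform B) (z : Z) : C := chi0 (form_eval s z).

Lemma form_char_add s : add_char (form_char s).
Proof.
have [c0 cD] := cchi0; split=> [|x y]; rewrite /form_char.
  by rewrite /form_eval /= !mxE !mulr0 !addr0.
by rewrite form_evalD cD.
Qed.

Lemma nondeg0 a : (forall x, chi0 (a * x) = 1) -> a = 0.
Proof.
move=> a1; apply/eqP; apply: contraT => /nondeg[x].
by rewrite a1 eqxx.
Qed.

Lemma form_eval_mk (s : zform B) (t t00 t01 t10 t11 : B) :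
  form_eval s (mk_Z t t00 t01 t10 t11) =
  s.1 * t + (s.2.1.1 * t00 + s.2.1.2 * t01 + (s.2.2.1 * t10 + s.2.2.2 * t11)).
Proof. by rewrite /form_eval /= !mxE. Qed.

Lemma form_char_inj s s' : (forall z, form_char s z = form_char s' z) -> s = s'.
Proof.
case: s s' => a [[w x] [y z]] [a' [[w' x'] [y' z']]] /= ss'.
have [c0 cD] := cchi0.
have E b b' : (forall t, chi0 (b * t) = chi0 (b' * t)) -> b = b'.
  move=> bb'; apply/eqP; rewrite -subr_eq0; apply/eqP/nondeg0 => t.
  by rewrite mulrBl cD bb' -cD subrr.
congr (_, ((_, _), (_, _))); apply: E => t.
- by have := ss' (mk_Z t 0 0 0 0); rewrite /form_char !form_eval_mk !mulr0 !addr0.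
- by have := ss' (mk_Z 0 t 0 0 0); rewrite /form_char !form_eval_mk !mulr0 !addr0 !add0r.
- by have := ss' (mk_Z 0 0 t 0 0); rewrite /form_char !form_eval_mk !mulr0 !addr0 !add0r.
- by have := ss' (mk_Z 0 0 0 t 0); rewrite /form_char !form_eval_mk !mulr0 !addr0 !add0r.
- by have := ss' (mk_Z 0 0 0 0 t); rewrite /form_char !form_eval_mk !mulr0 !add0r.
Qed.

Lemma form_char_surj (psi : Z -> C) : add_char psi -> exists s, forall z, psi z = form_char s z.
Proof.
move=> [p0 pD]; have [c0 cD] := cchi0.
have mkD (t t00 t01 t10 t11 t' t00' t01' t10' t11' : B) :
    mk_Z (t + t') (t00 + t00') (t01 + t01') (t10 + t10') (t11 + t11') =
    mk_Z t t00 t01 t10 t11 + mk_Z t' t00' t01' t10' t11'.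
  congr pair; apply/matrixP => i j; rewrite !mxE.
  by case: ifP => _; case: ifP.
have mk0 : mk_Z (0 : B) 0 0 0 0 = 0 :> Z.
  by congr pair; apply/matrixP => i j; rewrite !mxE; do 2?case: ifP.
have dl (f : B -> Z) : f 0 = 0 -> {morph f : t t' / t + t'} -> exists a, forall t, psi (f t) = chi0 (a * t).
  move=> f0 fD; apply: dual; split; first by rewrite f0 p0.
  by move=> t t'; rewrite fD pD.
have [||a aE] := dl (fun t : B => mk_Z t 0 0 0 0); first exact: mk0.
  by move=> t t' /=; rewrite -mkD !addr0.
have [||w wE] := dl (fun t : B => mk_Z 0 t 0 0 0); first exact: mk0.
  by move=> t t' /=; rewrite -mkD !addr0.
have [||x xE] := dl (fun t : B => mk_Z 0 0 t 0 0); first exact: mk0.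
  by move=> t t' /=; rewrite -mkD !addr0.
have [||y yE] := dl (fun t : B => mk_Z 0 0 0 t 0); first exact: mk0.
  by move=> t t' /=; rewrite -mkD !addr0.
have [||u uE] := dl (fun t : B => mk_Z 0 0 0 0 t); first exact: mk0.
  by move=> t t' /=; rewrite -mkD !addr0.
exists (a, ((w, x), (y, u))) => z; rewrite /form_char /form_eval /= !cD.
rewrite -aE -wE -xE -yE -uE -!pD -!mkD !addr0 !add0r; congr psi; exact: mk_ZE.
Qed.

(** The exponent of psi [v, u] is a linear form in v whose four coefficients are, up to sign, the
    left-hand sides in [kerset]; nondegeneracy of [chi0] makes each of them vanish. *)
Lemma radical_kerset a w x y z :
  #|radical (form_char (a, ((w, x), (y, z))))| = #|kerset a w x y z|.
Proof.
have [c0 cD] := cchi0.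
rewrite -(on_card_preimset (f := row_coord)); last first.
  by exists mk_row => v _; [apply: row_coordK|apply: mk_rowK].
apply: eq_card => u; rewrite !inE /row_coord.
have E v : form_eval (a, ((w, x), (y, z))) (Qcomm v u) =
    (a * lpart u idx1 + w * rpart u idx0 + x * rpart u idx1) * lpart v idx0 +
    ((- a * lpart u idx0 + y * rpart u idx0 + z * rpart u idx1) * lpart v idx1 +
    ((- (w * lpart u idx0 + y * lpart u idx1)) * rpart v idx0 + (- (x * lpart u idx0 + z * lpart u idx1)) * rpart v idx1)).
  by rewrite /Qcomm !QcocycleE /form_eval /= !mxE; ring.
apply/forallP/and4P => [uv|[/eqP e1 /eqP e2 /eqP e3 /eqP e4] v]; last first.
  by rewrite /form_char E e1 e2 e3 e4 oppr0 !mul0r !addr0 c0.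
have {}uv b : chi0 ((a * lpart u idx1 + w * rpart u idx0 + x * rpart u idx1) * b.1.1.1 +
    ((- a * lpart u idx0 + y * rpart u idx0 + z * rpart u idx1) * b.1.1.2 +
    ((- (w * lpart u idx0 + y * lpart u idx1)) * b.1.2 + (- (x * lpart u idx0 + z * lpart u idx1)) * b.2))) = 1.
  have /eqP := uv (mk_row b); rewrite /form_char E.
  by have := mk_rowK b; case: b => [[[b1 b2] b3] b4] [-> -> -> ->].
split; rewrite -?(oppr_eq0 (_ * lpart u idx0 + _)); apply/eqP/nondeg0 => t.
- by rewrite -(uv (t, 0, 0, 0)) /= !mulr0 !addr0.
- by rewrite -(uv (0, t, 0, 0)) /= !mulr0 !addr0 add0r.
- by rewrite -(uv (0, 0, t, 0)) /= !mulr0 !addr0 !add0r.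
- by rewrite -(uv (0, 0, 0, t)) /= !mulr0 !add0r.
Qed.
End Forms.

(** * Continuous representations over the completion *)

Section CompletionGroup.
Variables (R : realType) (K : fieldExtType rat) (p : prime_idealr (ring_of_integers K)).
Hypothesis p_neq0 : exists2 x : ring_of_integers K, x \in p & x != 0.
Local Notation A := (ring_of_integers K).
Local Notation O := (completion p).
Local Notation C := (Cplx R).
Local Notation G := (Qgroup 1 1 (completion p)).
Local Notation Z := (Zspan 1 1 (completion p)).
Local Notation q := (ncard [set: {ideal_quot p}]).

(* The level is shifted: level_quo k is A / p^(k+1). *)
Definition level_quo k : finComNzRingType := fin_of (finite_quot_exp p_neq0 k).

Definition red k (x : O) : level_quo k := cproj x k.

Lemma redD k x y : red k (x + y) = red k x + red k y. Proof. by []. Qed.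
Lemma red0 k : red k 0 = 0.
Proof. by apply: (addrI (red k 0)); rewrite -redD !addr0. Qed.

Definition red_lift k (b : level_quo k) : O :=
  completion_of p (repr (b : {ideal_quot (ideal_expS p k)})).

Lemma red_liftK k : cancel (@red_lift k) (@red k).
Proof. by move=> b; rewrite /red /= reprK. Qed.

Definition redu k (u : 'rV[O]_(2 * 1 + 2 * 1)) : 'rV[level_quo k]_(2 * 1 + 2 * 1) :=
  map_mx (@red k) u.
Definition redZ k (z : Z) : Zspan 1 1 (level_quo k) := (red k z.1, map_mx (@red k) z.2).
Definition redG k (g : G) : Qgroup 1 1 (level_quo k) := (redu k g.1, redZ k g.2).

Lemma reduD k u v : redu k (u + v) = redu k u + redu k v.
Proof. by apply/matrixP => i j; rewrite !mxE. Qed.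

Lemma redZD k z z' : redZ k (z + z') = redZ k z + redZ k z'.
Proof. by congr pair; apply/matrixP => i j; rewrite !mxE. Qed.

Lemma redu0 k : redu k 0 = 0.
Proof. by apply/matrixP => i j; rewrite !mxE red0. Qed.

Lemma redZ0 k : redZ k 0 = 0.
Proof. by apply: (addrI (redZ k 0)); rewrite -redZD !addr0. Qed.

Lemma redZB k z z' : redZ k (z - z') = redZ k z - redZ k z'.
Proof. by apply: (addIr (redZ k z')); rewrite -redZD !subrK. Qed.

Lemma red_cocycle k u v : redZ k (Qcocycle u v) = Qcocycle (redu k u) (redu k v).
Proof.
rewrite !QcocycleE; congr pair; first by rewrite /lpart !mxE.
by apply/matrixP => i j; rewrite /lpart /rpart !mxE.
Qed.

Lemma redG_mul k g h : redG k (g * h)%g = (redG k g * redG k h)%g.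
Proof. by rewrite !QmulE /Qmul /redG /= reduD !redZD red_cocycle. Qed.

Lemma redG1 k : redG k 1%g = 1%g.
Proof. by rewrite /redG /= redu0 redZ0. Qed.

Lemma redG_expg k g n : redG k g = 1%g -> redG k (g ^+ n)%g = 1%g.
Proof.
by move=> g1; elim: n => [|n IH]; rewrite ?expg0 ?redG1 // expgS redG_mul g1 IH mul1g.
Qed.

Lemma redG_le j k g h : (j <= k)%N -> redG k g = redG k h -> redG j g = redG j h.
Proof.
move=> jk [/matrixP gu gz /matrixP gZ]; congr (_, (_, _)).
- by apply/matrixP => a b; have := gu a b; rewrite !mxE; apply: cproj_le.
- exact: cproj_le gz.
- by apply/matrixP => a b; have := gZ a b; rewrite !mxE; apply: cproj_le.
Qed.

Definition redu_lift k (u : 'rV[level_quo k]_(2 * 1 + 2 * 1)) : 'rV[O]_(2 * 1 + 2 * 1) :=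
  map_mx (@red_lift k) u.
Definition redZ_lift k (z : Zspan 1 1 (level_quo k)) : Z :=
  (red_lift z.1, map_mx (@red_lift k) z.2).

Lemma redu_liftK k : cancel (@redu_lift k) (@redu k).
Proof. by move=> u; apply/matrixP => i j; rewrite !mxE red_liftK. Qed.

Lemma redZ_liftK k : cancel (@redZ_lift k) (@redZ k).
Proof.
case=> t M; congr pair; first exact: red_liftK.
by apply/matrixP => i j; rewrite !mxE red_liftK.
Qed.

Lemma redG_surj k g : exists h, redG k h = g.
Proof.
by exists (redu_lift g.1, redZ_lift g.2); case: g => u z; rewrite /redG /= redu_liftK redZ_liftK.
Qed.

Lemma nbhs_red (x : O) (W : set O) : nbhs x W -> exists k, forall y, red k y = red k x -> W y.
Proof. by move=> [k _ kW]; exists k. Qed.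

Lemma red_le (j k : nat) (x y : O) : (j <= k)%N -> red k y = red k x -> red j y = red j x.
Proof. by move=> jk; apply: cproj_le. Qed.

Lemma nbhs_red_mx m n (M : 'M[O]_(m, n)) (W : set 'M[O]_(m, n)) : nbhs M W ->
  exists k, forall N : 'M[O]_(m, n), (forall i j, red k (N i j) = red k (M i j)) -> W N.
Proof.
move=> [P MP PW]; have /choice[f fP] : forall ij : 'I_m * 'I_n, exists k, forall y,
    red k y = red k (M ij.1 ij.2) -> P ij.1 ij.2 y by move=> ij; apply/nbhs_red/MP.
exists (\max_ij f ij)%N => N NM; apply: PW => i j; apply: (fP (i, j)).
by apply: red_le (NM i j); apply: (@leq_bigmax _ f (i, j)).
Qed.

Lemma nbhs_redG (g : G) (W : set G) : nbhs g W ->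
  exists k, forall h, redG k h = redG k g -> W h.
Proof.
move=> [[U V] /= [/nbhs_red_mx[i iU]] [[V1 V2] /= [/nbhs_red[j jV] /nbhs_red_mx[k kV]] VW] UW].
exists (maxn i (maxn j k)) => h [hu hz hZ]; apply: UW; split=> /=.
  apply: iU => a b; apply: (@red_le _ (maxn i (maxn j k))); first exact: leq_maxl.
  by have /matrixP/(_ a b) := hu; rewrite !mxE.
apply: VW; split=> /=.
  by apply/jV/(red_le _ hz); rewrite maxnCA leq_maxl.
apply: kV => a b; apply: (@red_le _ (maxn i (maxn j k))); first by rewrite maxnA leq_maxr.
by have /matrixP/(_ a b) := hZ; rewrite !mxE.
Qed.

Lemma nbhs_red_fiber (x : O) k : nbhs x [set y | red k y = red k x].
Proof. by exists k. Qed.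

Lemma redG_fiber_nbhs (g : G) k : nbhs g [set h | redG k h = redG k g].
Proof.
exists ([set u | redu k u = redu k g.1], [set z | redZ k z = redZ k g.2]) => /=.
  split.
    exists (fun i j => [set y | red k y = red k (g.1 i j)]) => [i j|N NM].
      exact: nbhs_red_fiber.
    by apply/matrixP => i j; rewrite !mxE; apply: NM.
  exists ([set y | red k y = red k g.2.1],
     [set M | map_mx (@red k) M = map_mx (@red k) g.2.2]) => /=.
    split; first exact: nbhs_red_fiber.
    exists (fun i j => [set y | red k y = red k (g.2.2 i j)]) => [i j|N NM].
      exact: nbhs_red_fiber.
    by apply/matrixP => i j; rewrite !mxE; apply: NM.
  by move=> [z1 z2] /= [z1E z2E]; rewrite /redZ /= z1E z2E.
by move=> [u z] /= [uE zE]; rewrite /redG /= uE zE.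
Qed.
End CompletionGroup.

(** * Real-valued norm and small powers of complex numbers *)

Section ComplexNorm.
Variable R : realType.
Local Notation C := (Cplx R).

(** The norm of [C] takes values in [C]; its real copy gives access to real order arithmetic and
    real limits. *)
Definition cnorm (z : C) : R := complex.Re `|z|.

Lemma cnormE (z : C) : `|z| = (cnorm z)%:C%C.
Proof. by rewrite /cnorm RRe_real // normr_real. Qed.

Lemma cnormM (x y : C) : cnorm (x * y) = cnorm x * cnorm y.
Proof. by apply: complexI; rewrite rmorphM /= -!cnormE normrM. Qed.

Lemma cnorm_ge0 (x : C) : 0 <= cnorm x.
Proof. by rewrite -lecR -cnormE normr_ge0. Qed.

Lemma cnormD (x y : C) : cnorm (x + y) <= cnorm x + cnorm y.
Proof. by rewrite -lecR rmorphD /= -!cnormE ler_normD. Qed.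

Lemma cnorm_eq0 (x : C) : cnorm x = 0 -> x = 0.
Proof. by move=> x0; apply/normr0_eq0; rewrite cnormE x0. Qed.

Lemma cnorm_lt (x : C) (e : R) : (`|x| < e%:C%C) = (cnorm x < e).
Proof. by rewrite cnormE ltcR. Qed.

(* Unless w = 1, the distance of w^(2^k) to 1 grows like (3/2)^k. *)
Lemma powers_near1 (w : C) : (forall n, cnorm (w ^+ n - 1) < 2^-1) -> w = 1.
Proof.
move=> wn; apply/eqP; rewrite -subr_eq0; apply: contraT => w1.
have a0 : 0 < cnorm (w - 1).
  by rewrite lt_neqAle cnorm_ge0 andbT eq_sym; apply: contra w1 => /eqP/cnorm_eq0 ->.
have grow k : (1 + k%:R / 2) * cnorm (w - 1) <= cnorm (w ^+ (2 ^ k) - 1).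
  elim: k => [|k IH]; first by rewrite expn0 expr1; lra.
  have -> : w ^+ (2 ^ k.+1) - 1 = (w ^+ (2 ^ k) - 1) * (w ^+ (2 ^ k) + 1).
    by rewrite expnS mulnC exprM; ring.
  rewrite cnormM; set b := cnorm (w ^+ (2 ^ k) - 1) in IH *; have bn : b < 2^-1 := wn _.
  have : 2 <= b + cnorm (w ^+ (2 ^ k) + 1).
    have -> : (2 : R) = cnorm (2 : C).
      by apply: complexI; rewrite -cnormE normr_nat rmorph_nat.
    have -> : (2 : C) = - (w ^+ (2 ^ k) - 1) + (w ^+ (2 ^ k) + 1) by ring.
    apply: le_trans (cnormD _ _) _; rewrite lerD2r /b /cnorm normrN //.
  move=> b2; have b32 : 3 / 2 <= cnorm (w ^+ (2 ^ k) + 1) by lra.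
  apply: le_trans (_ : b * (3 / 2) <= _); last first.
    by rewrite ler_wpM2l // cnorm_ge0.
  apply: le_trans (_ : (1 + k%:R / 2) * cnorm (w - 1) * (3 / 2) <= _); last first.
    by rewrite ler_wpM2r //; lra.
  rewrite mulrAC ler_wpM2r // ?cnorm_ge0 // -natr1.
  have : (0 : R) <= k%:R by []. lra.
have := grow (Num.bound (cnorm (w - 1))^-1); have := wn (2 ^ Num.bound (cnorm (w - 1))^-1)%N.
have : 1 < (Num.bound (cnorm (w - 1))^-1)%:R * cnorm (w - 1).
  by rewrite -ltr_pdivrMr // div1r archi_boundP // invr_ge0 ltW.
move: (Num.bound _)%:R => m; lra.
Qed.

Lemma nbhs_cnorm (x : C) (e : R) : 0 < e -> nbhs x [set z | cnorm (z - x) < e].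
Proof.
move=> e0; apply/nbhs_ballP; exists (e%:C)%C; first by rewrite /= ltcR.
by move=> z; rewrite -ball_normE /= distrC cnorm_lt.
Qed.
End ComplexNorm.

(** * Central characters of continuous representations and twisting *)

Section ContinuousReps.
Variables (R : realType) (K : fieldExtType rat) (p : prime_idealr (ring_of_integers K)).
Hypothesis p_neq0 : exists2 x : ring_of_integers K, x \in p & x != 0.
Local Notation O := (completion p).
Local Notation C := (Cplx R).
Local Notation G := (Qgroup 1 1 (completion p)).
Local Notation Z := (Zspan 1 1 (completion p)).
Local Notation q := (ncard [set: {ideal_quot p}]).
Local Notation level_quo := (level_quo p_neq0).

Lemma cont_repr_hom d (rho : G -> 'M[C]_d) : cont_repr rho -> mx_hom rho.
Proof. by case. Qed.

Lemma locally_const_continuous d (rho : G -> 'M[C]_d) k :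
  (forall g h, redG p_neq0 k h = redG p_neq0 k g -> rho h = rho g) -> continuous rho.
Proof.
move=> rk g W /nbhs_singleton Wg.
apply: filterS (redG_fiber_nbhs p_neq0 g k) => h /rk hg.
by rewrite /= hg.
Qed.

(** The non-zero complex numbers have no small subgroups: a congruence kernel is stable under
    powers, so all powers of [a] stay close to 1. *)
Lemma scalar_trivial d (rho : G -> 'M[C]_d) : cont_repr rho -> (0 < d)%N ->
  exists k, forall g a, redG p_neq0 k g = 1%g -> rho g = a%:M -> a = 1.
Proof.
move=> [r1 rM rc] d0; pose i := Ordinal d0.
pose W : set G := [set g | cnorm (rho g i i - 1) < 2^-1].
have : nbhs (1%g : G) W.
  have := rc 1%g [set M | cnorm (M i i - 1) < 2^-1]; apply.
  exists (fun a b => [set z | cnorm (z - (rho 1%g) a b) < 2^-1]) => [a b|M MP].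
    by apply: nbhs_cnorm; rewrite invr_gt0.
  by have := MP i i; rewrite /= r1 mxE eqxx.
move=> /(nbhs_redG p_neq0)[k kW]; exists k => g a g1 ga.
apply: powers_near1 => n.
have : W (g ^+ n)%g by apply: kW; rewrite redG_expg // redG1.
rewrite /W /=; have -> : rho (g ^+ n)%g = (a ^+ n)%:M.
  by elim: n => [|n IH]; rewrite ?expg0 // expgS rM IH ga exprS scalar_mxM.
by rewrite mxE eqxx.
Qed.

Definition trivial_at k (psi : Z -> C) := forall z, redZ p_neq0 k z = 0 -> psi z = 1.

Lemma trivial_at_eq k (psi : Z -> C) z z' : add_char psi -> trivial_at k psi ->
  redZ p_neq0 k z = redZ p_neq0 k z' -> psi z = psi z'.
Proof.
move=> [p0 pD] pk zz'; rewrite -[z](subrK z') pD pk ?mul1r //.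
by rewrite redZB zz' subrr.
Qed.

Lemma cont_irr_psi d (rho : G -> 'M[C]_d) : cont_irr R G d rho ->
  exists psi k, [/\ central_char rho psi, add_char psi & trivial_at k psi].
Proof.
move=> [cr ir]; have hr := cont_repr_hom cr.
have [psi [rz psiC]] := irr_central_char hr ir.
have [k kP] := scalar_trivial cr ir.1; exists psi, k; split=> // z z0.
apply: (kP (0, z)) => //.
by congr pair; [exact: redu0 | exact: z0].
Qed.

(** If g and h agree modulo a high power of p, then psi kills the commutators with h g^-1; Schur
    makes its image scalar, and [scalar_trivial] makes that scalar 1. *)
Lemma cont_irr_locally_const d (rho : G -> 'M[C]_d) : cont_irr R G d rho ->
  exists k, forall g h, redG p_neq0 k h = redG p_neq0 k g -> rho h = rho g.
Proof.
move=> cirr; have [psi [k [rz psiC pk]]] := cont_irr_psi cirr.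
have [cr ir] := cirr; have hr := cont_repr_hom cr; have [r1 rM] := hr.
have [j jP] := scalar_trivial cr ir.1; exists (maxn j k) => g h gh.
have hg1 : redG p_neq0 (maxn j k) (h * g^-1)%g = 1%g.
  by rewrite redG_mul gh -redG_mul mulgV redG1.
suff E : rho (h * g^-1)%g = 1%:M by rewrite -[h](mulgVK g) rM E mul1mx.
have [f fM] : exists a, rho (h * g^-1)%g = a%:M.
  apply: (schur_scalar ir) => x; rewrite (central_char_comm _ _ hr rz) pk ?scale1r //.
  have : redG p_neq0 k (h * g^-1)%g = 1%g.
    by rewrite -(redG1 p_neq0 k); apply: (redG_le (leq_maxr j k)); rewrite redG1.
  case=> hg _; rewrite /Qcomm redZB !red_cocycle hg Qcocycle0l Qcocycle0r.
  by rewrite subrr.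
rewrite fM (jP _ _ _ fM) // -(redG1 p_neq0 j).
by apply: (redG_le (leq_maxl j k)); rewrite redG1.
Qed.

Lemma twist_equiv_same_psi d (rho sigma : G -> 'M[C]_d) psi :
  cont_irr R G d rho -> cont_irr R G d sigma ->
  central_char rho psi -> central_char sigma psi -> twist_equiv rho sigma.
Proof.
move=> crho csig rz sz; have [cr ir] := crho; have [cs is'] := csig.
have hr := cont_repr_hom cr; have hs := cont_repr_hom cs.
have [r1 rM] := hr; have [s1 sM] := hs.
have [X [chi [[Y XY] _ chiE]]] := projective_intertwiner hs hr is' ir
  (fun g h => central_char_comm g h hs sz) (fun g h => central_char_comm g h hr rz).
have Xu : X \in unitmx by case/mulmx1_unit: XY.
have XrI g a b : a *: (X *m rho g) = b *: (X *m rho g) -> a = b.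
  move=> /eqP; rewrite -subr_eq0 -scalerBl scaler_eq0 subr_eq0 => /orP[/eqP //|].
  move=> /eqP/(congr1 (mulmx (invmx X))); rewrite mulKmx // mulmx0.
  move=> /(congr1 (mulmxr (rho g^-1%g))) /=; rewrite mx_homV // mul0mx.
  have [d0 _] := ir; move=> /matrixP/(_ (Ordinal d0) (Ordinal d0)).
  by rewrite !mxE eqxx => /eqP; rewrite oner_eq0.
have chi1 : chi 1%g = 1.
  by apply: (@XrI 1%g); rewrite -chiE s1 r1 mul1mx mulmx1 scale1r.
have chiM g h : chi (g * h)%g = chi g * chi h.
  apply: (@XrI (g * h)%g); rewrite -chiE sM -mulmxA chiE -scalemxAr mulmxA chiE.
  by rewrite -scalemxAl scalerA mulrC -mulmxA rM.
exists (fun g => (chi g)%:M); last first.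
  exists X => // g; rewrite /repr_twist mxE eqxx mulr1n -scalemxAr -scalemxAl.
  by rewrite scalemxAl -chiE mulmxK.
split; first by rewrite chi1.
  by move=> g h; rewrite chiM scalar_mxM.
(* [chi] is determined by [rho] and [sigma], hence locally constant at the larger of their
   levels. *)
have [j jr] := cont_irr_locally_const crho; have [k ks] := cont_irr_locally_const csig.
apply: (@locally_const_continuous _ _ (maxn j k)) => g h gh; congr (_%:M).
have rgh := jr _ _ (redG_le (leq_maxl j k) gh).
have sgh := ks _ _ (redG_le (leq_maxr j k) gh).
by apply: (@XrI g); rewrite -chiE -[in LHS]rgh -chiE sgh.
Qed.

(* The centre is generated by commutators. *)
Lemma character_center (c : G -> C) : c 1%g = 1 -> (forall g h, c (g * h)%g = c g * c h) ->
  forall z, c (0, z) = 1.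
Proof.
move=> c1 cM; have c_neq0 g : c g != 0.
  by apply: contra (oner_neq0 C) => /eqP cg; rewrite -c1 -(mulgV g) cM cg mul0r.
have ccommG (g h : G) : c (0, Qcomm g.1 h.1) = 1.
  have E : c g * c h = c h * c g * c (0, Qcomm g.1 h.1).
    by rewrite -(cM g h) Qmul_comm (cM (h * g)%g) (cM h g).
  apply: (mulfI (mulf_neq0 (c_neq0 h) (c_neq0 g))).
  by rewrite -E mulr1 mulrC.
have ccomm u v : c (0, Qcomm u v) = 1 := ccommG (u, 0) (v, 0).
have cD z z' : c (0, z + z') = c (0, z) * c (0, z').
  by rewrite -cM; congr c; rewrite QmulE /Qmul /= Qcocycle0l !addr0.
(* By bilinearity one commutator covers a whole column of the matrix part, so three commutators
   reach every central element. *)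
have comm_mk t a b e f : mk_Z t a b e f = Qcomm (mk_row (t, 0, 0, 0)) (mk_row (0, 1, 0, 0)) +
   (Qcomm (mk_row (a, e, 0, 0)) (mk_row (0, 0, 1, 0)) +
    Qcomm (mk_row (b, f, 0, 0)) (mk_row (0, 0, 0, 1))) :> Z.
  rewrite /Qcomm !QcocycleE.
  have lpartE (x : O * O * O * O) : lpart (mk_row x) idx0 = x.1.1.1 /\ lpart (mk_row x) idx1 = x.1.1.2.
    by rewrite /lpart /mk_row !row_mxEl !mxE.
  have rpartE (x : O * O * O * O) : rpart (mk_row x) idx0 = x.1.2 /\ rpart (mk_row x) idx1 = x.2.
    by rewrite /rpart /mk_row !row_mxEr !mxE.
  congr pair.
    by rewrite /= !(lpartE _).1 !(lpartE _).2 /=; ring.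
  apply/matrixP => i j; rewrite !mxE; elim/ord2P: i; elim/ord2P: j => /=;
    by rewrite ?(lpartE _).1 ?(lpartE _).2 ?(rpartE _).1 ?(rpartE _).2 /=; ring.
have cD3 x y z : c (0, x) = 1 -> c (0, y) = 1 -> c (0, z) = 1 -> c (0, x + (y + z)) = 1.
  by move=> cx cy cz; rewrite cD cx cD cy cz !mulr1.
by move=> z; rewrite (mk_ZE z) comm_mk; apply: cD3; apply: ccomm.
Qed.

Lemma twist_equiv_psi d (rho sigma : G -> 'M[C]_d) psi psi' : (0 < d)%N ->
  central_char rho psi -> central_char sigma psi' -> twist_equiv rho sigma -> psi = psi'.
Proof.
move=> d0 rz sz [chi [chi1 chiM _] [X Xu sE]]; apply: funext => z.
have chiz : chi (0, z) 0 0 = 1.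
  apply: (@character_center (fun g => chi g 0 0)); first by rewrite chi1 mxE.
  by move=> g h; rewrite chiM mxE big_ord1.
have := sE (0, z); rewrite /repr_twist chiz scale1r sz rz scalar_mxC mulmxK //.
by move=> /matrixP/(_ (Ordinal d0) (Ordinal d0)); rewrite !mxE eqxx.
Qed.

Section Level.
Variables (k : nat) (chi0 : level_quo k -> C).
Hypothesis cchi0 : add_char chi0.
Hypothesis nondeg : forall a, a != 0 -> exists x, chi0 (a * x) != 1.
Hypothesis dual : forall chi, add_char chi -> exists a, forall x, chi x = chi0 (a * x).

Definition level_char (s : zform (level_quo k)) (z : Z) : C :=
  form_char chi0 s (redZ p_neq0 k z).

Lemma level_char_inj s s' : level_char s = level_char s' -> s = s'.
Proof.
move=> ss'; apply: (form_char_inj cchi0 nondeg) => z.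
by have := congr1 (fun f => f (redZ_lift z)) ss'; rewrite /level_char redZ_liftK.
Qed.

Lemma level_char_surj psi : add_char psi -> trivial_at k psi -> exists s, psi = level_char s.
Proof.
move=> psiC pk; have [p0 pD] := psiC.
have [|s sE] := @form_char_surj _ _ _ cchi0 dual (fun z => psi (redZ_lift z)).
  split=> [|x y].
    rewrite -p0; apply: (trivial_at_eq psiC pk); by rewrite redZ_liftK redZ0.
  by rewrite -pD; apply: (trivial_at_eq psiC pk); rewrite redZD !redZ_liftK.
exists s; apply: funext => z; rewrite /level_char -sE.
by apply: (trivial_at_eq psiC pk); rewrite redZ_liftK.
Qed.

Definition zform_ker (s : zform (level_quo k)) : nat :=
  #|kerset s.1 s.2.1.1 s.2.1.2 s.2.2.1 s.2.2.2|.

Lemma level_rep s : exists d (rho : G -> 'M[C]_d),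
  [/\ cont_irr R G d rho, central_char rho (level_char s) &
    (d ^ 2 * zform_ker s = #|level_quo k| ^ 4)%N].
Proof.
have sC := form_char_add cchi0 s.
have [d [rho [ir hr rz]]] := irr_rep_exists sC.
exists d, (fun g => rho (redG p_neq0 k g)); split; last first.
- rewrite -(dim_radical sC hr ir rz); congr (_ * _)%N.
  by rewrite /zform_ker -(radical_kerset cchi0 nondeg); case: s {sC rz} => ? [[? ?] [? ?]].
- by move=> z; rewrite /redG /= redu0; apply: rz.
have [r1 rM] := hr; split; last first.
  have [d0 irU] := ir; split=> // U gU; apply: irU => g v vU.
  by have [h <-] := redG_surj g; apply: gU.
split; first by rewrite redG1.
  by move=> g h; rewrite redG_mul.
by apply: (@locally_const_continuous _ _ k) => g h ->.
Qed.

(** The central character determines the dimension, since the intertwiner with the representation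
    inflated from level [k] has inverses on both sides. *)
Lemma level_dim s d (rho : G -> 'M[C]_d) : cont_irr R G d rho ->
  central_char rho (level_char s) -> (d ^ 2 * zform_ker s = #|level_quo k| ^ 4)%N.
Proof.
move=> [cr ir] rz; have [d' [sigma [[cs is'] sz <-]]] := level_rep s.
have hr := cont_repr_hom cr; have hs := cont_repr_hom cs.
have [X [chi [[Y XY] [Y' YX] _]]] := projective_intertwiner hr hs ir is'
  (fun g h => central_char_comm g h hr rz) (fun g h => central_char_comm g h hs sz).
by have -> : d = d' by apply/eqP; rewrite eqn_leq (mulmx1_min XY) (mulmx1_min YX).
Qed.
End Level.
End ContinuousReps.

Lemma expn_mul_cancel a d i n : (1 < a -> i <= n -> d * a ^ i = a ^ n -> d = a ^ (n - i))%N.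
Proof.
move=> a1 ilen da; apply/eqP; rewrite -(@eqn_pmul2r (a ^ i)) ?expn_gt0 ?(ltnW a1) //.
by rewrite da -expnD subnK.
Qed.

Lemma sqr_expn_inj a b : (a ^ 2 = b ^ 2 -> a = b)%N.
Proof. by move=> /eqP; rewrite eqn_exp2r // => /eqP. Qed.

(** * Counting twist classes by dimension *)

Section ClassCount.
Variables (R : realType) (K : fieldExtType rat) (p : prime_idealr (ring_of_integers K)).
Hypothesis p_neq0 : exists2 x : ring_of_integers K, x \in p & x != 0.
Local Notation O := (completion p).
Local Notation C := (Cplx R).
Local Notation G := (Qgroup 1 1 (completion p)).
Local Notation Z := (Zspan 1 1 (completion p)).
Local Notation q := (ncard [set: {ideal_quot p}]).
Local Notation level_quo := (level_quo p_neq0).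
Local Notation quo_class k x := (\pi_{ideal_quot (ideal_expS p k)} x : level_quo k).

Lemma residue_gt1 : (1 < q)%N.
Proof. by have [pi [_ /unif_res_gt1]] := quot_exp_chain p_neq0 0. Qed.

(** Since [pi] maps p^(k + 1) into p^(k + 2), a form at level [k.+1] with coefficients divisible by
    [pi] vanishes on everything that is zero at level [k]. *)
Lemma red_unif_mul k pi (x : O) : pi \in p -> red p_neq0 k x = 0 ->
  (quo_class k.+1 pi) * red p_neq0 k.+1 x = 0.
Proof.
move=> pip; rewrite /red cprojP => /eqP.
rewrite -[X in _ == X](rmorph0 (\pi_{ideal_quot (ideal_expS p k)})) -Quotient.idealrBE subr0.
move=> /asboolP xk; rewrite -[cproj x k.+1]reprK.
apply: etrans (esym (rmorphM (\pi_{ideal_quot (ideal_expS p k.+1)}) _ _)) _.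
rewrite -[RHS](rmorph0 (\pi_{ideal_quot (ideal_expS p k.+1)})).
apply/eqP; rewrite -Quotient.idealrBE subr0; apply/asboolP.
exists [:: (pi, repr (cproj x k.+1))]; last by rewrite big_seq1.
by move=> ab; rewrite inE => /eqP->.
Qed.

Lemma level_dimE k (s : zform (level_quo k)) d :
  (d ^ 2 * zform_ker s = #|level_quo k| ^ 4)%N ->
  exists pi i, [/\ pi \in p, chain_ring (quo_class k pi) k.+1 q,
    (d * q ^ i = q ^ (2 * k.+1))%N, zform_ker s = ((q ^ i) ^ 2)%N &
    [/\ (i <= 2 * k.+1)%N, (k.+1 <= i)%N = (s.2.1.1 * s.2.2.2 - s.2.1.2 * s.2.2.1 == 0) &
     (k.+1 < i)%N -> [/\ dvdB (quo_class k pi) s.1,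
        dvdB (quo_class k pi) s.2.1.1,
        dvdB (quo_class k pi) s.2.1.2,
        dvdB (quo_class k pi) s.2.2.1 &
        dvdB (quo_class k pi) s.2.2.2]]].
Proof.
have [pi [pip ch]] := quot_exp_chain p_neq0 k; rewrite (chain_card ch) => dE.
have [i [iK ile idet ipi]] := ker_card ch s.1 s.2.1.1 s.2.1.2 s.2.2.1 s.2.2.2.
exists pi, i; split=> //; apply: sqr_expn_inj; rewrite expnMn -iK dE -!expnM.
by congr (q ^ _)%N; lia.
Qed.

(* The dimension forces more than k + 2 in the exponent of the kernel, so that
   no coefficient of the form of psi is a unit. *)
Lemma descend_level k d (rho : G -> 'M[C]_d) psi : cont_irr R G d rho ->
  central_char rho psi -> add_char psi -> (d <= q ^ k.+1)%N ->
  trivial_at p_neq0 k.+1 psi -> trivial_at p_neq0 k psi.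
Proof.
move=> crho rz psiC dq pk; have [pi0 [_ ch0]] := quot_exp_chain p_neq0 k.+1.
have [chi0 [cchi0 nondeg dual]] := chain_ring_dual C ch0.
have [s sE] := level_char_surj cchi0 dual psiC pk.
rewrite sE in rz; have := level_dim cchi0 nondeg crho rz.
move=> /level_dimE[pi [i [pip _ dqi _ [_ _ ipi]]]].
have q1 := residue_gt1.
have : (k.+2 < i)%N.
  have : (q ^ (2 * k.+2) <= q ^ k.+1 * q ^ i)%N by rewrite -dqi leq_mul2r dq orbT.
  by rewrite -expnD leq_exp2l //; lia.
move=> /ipi[d1 d2 d3 d4 d5] z [z1 /matrixP z2].
have kill b (x : O) : dvdB (quo_class k.+1 pi) b ->
    red p_neq0 k x = 0 -> b * red p_neq0 k.+1 x = 0.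
  by move=> /dvdBP[c ->] x0; rewrite mulrAC red_unif_mul // mul0r.
have z0 r c : red p_neq0 k (z.2 r c) = 0 by have := z2 r c; rewrite !mxE.
have [c0 _] := cchi0.
rewrite sE /level_char /form_char /form_eval /= !mxE.
rewrite (kill _ _ d1 z1) (kill _ _ d2 (z0 idx0 idx0)) (kill _ _ d3 (z0 idx0 idx1)).
by rewrite (kill _ _ d4 (z0 idx1 idx0)) (kill _ _ d5 (z0 idx1 idx1)) !addr0.
Qed.

Lemma trivial_at_le j k (psi : Z -> C) : (j <= k)%N ->
  trivial_at p_neq0 j psi -> trivial_at p_neq0 k psi.
Proof.
move=> jk pj z zk; apply: pj.
have : redG p_neq0 j (0, z) = redG p_neq0 j 1%g.
  by apply: (redG_le jk); rewrite redG1 /redG /= redu0 zk.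
by rewrite redG1 => -[_ z1 z2]; apply/pair_equal_spec.
Qed.

(** The bound on [d] also holds with any larger level in place of [k], so [descend_level] can be
    repeated down to [k]. *)
Lemma small_dim_level k d (rho : G -> 'M[C]_d) : cont_irr R G d rho -> (d <= q ^ k.+1)%N ->
  exists psi, [/\ central_char rho psi, add_char psi & trivial_at p_neq0 k psi].
Proof.
move=> crho dq; have [psi [j [rz psiC pj]]] := cont_irr_psi p_neq0 crho.
exists psi; split=> //; have {}pj : trivial_at p_neq0 (j + k) psi.
  by apply: trivial_at_le pj; apply: leq_addr.
elim: j pj => [//|j IH] pj; apply: IH.
apply: (descend_level crho rz psiC _ pj); apply: leq_trans dq _.
by rewrite leq_exp2l; [exact: (leq_addl j k)|exact: residue_gt1].
Qed.

(** A twist class consists of all representations with one central character. The bound on [d] puts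
    that character at level [k], where forms parametrize characters, and the equation on [s] says
    that the dimension is [d]. *)
Lemma twist_classes_level k d : (0 < d)%N -> (d <= q ^ k.+1)%N ->
  finite_set (twist_isoclasses R G d) /\
  ncard (twist_isoclasses R G d) =
    #|[set s : zform (level_quo k) | d ^ 2 * zform_ker s == #|level_quo k| ^ 4]%SET|%N.
Proof.
move=> d0 dq; have [pi0 [_ ch0]] := quot_exp_chain p_neq0 k.
have [chi0 [cchi0 nondeg dual]] := chain_ring_dual C ch0.
set S := [set s | _]%SET.
pose cls (s : zform (level_quo k)) : set (G -> 'M[C]_d) :=
  [set sigma | cont_irr R G d sigma /\ central_char sigma (level_char chi0 s)].
have clsE rho s : cont_irr R G d rho -> central_char rho (level_char chi0 s) ->
    twist_isoclass rho = cls s.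
  move=> crho rz; apply/seteqP; split=> sigma [csig].
    move=> rs; split=> //; have [psi [j [sz _ _]]] := cont_irr_psi p_neq0 csig.
    by rewrite (twist_equiv_psi d0 rz sz rs).
  by move=> sz; split=> //; apply: (twist_equiv_same_psi p_neq0 crho csig rz sz).
have clsS s : s \in S -> exists2 rho, cont_irr R G d rho & central_char rho (level_char chi0 s).
  rewrite inE => /eqP dE; have [d' [rho [crho rz d'E]]] := level_rep cchi0 nondeg s.
  have : (d' ^ 2 * zform_ker s == d ^ 2 * zform_ker s)%N by rewrite d'E dE.
  rewrite eqn_pmul2r => [/eqP/sqr_expn_inj dd'|]; first by subst d'; exists rho.
  by have [_ [i [_ _ _ -> _]]] := level_dimE dE; rewrite !expn_gt0 (ltnW residue_gt1).
have -> : twist_isoclasses R G d = [set cls s | s in [set` S]].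
  apply/seteqP; split=> X.
    move=> [rho crho <-]; have [psi [rz psiC pk]] := small_dim_level crho dq.
    have [s sE] := level_char_surj cchi0 dual psiC pk; rewrite sE in rz.
    have sS : s \in S by rewrite inE; apply/eqP/(level_dim cchi0 nondeg crho rz).
    exists s; [exact: sS | exact/esym/clsE].
  move=> [s sS <-]; have [rho crho rz] := clsS s sS.
  by exists rho => //; apply: clsE.
split; first exact/finite_image/finite_finset.
apply: ncard_imset => s s' sS _ ss'; have [rho crho rz] := clsS s sS.
have : cls s rho by split; [exact: crho|exact: rz].
rewrite ss' => -[_ rz'].
apply: (level_char_inj cchi0 nondeg); apply: funext => z.
exact: (scalar_mx_inj d0 (etrans (esym (rz z)) (rz' z))).
Qed.

Lemma twist_classes0 : twist_isoclasses R G 0 = set0.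
Proof. by apply/seteqP; split=> X // [rho [_ []]]. Qed.

Lemma twist_classes_finite d : finite_set (twist_isoclasses R G d).
Proof.
case: d => [|d]; first by rewrite twist_classes0.
have [] // := @twist_classes_level d.+1 d.+1; have q1 := residue_gt1.
by apply: leq_trans (ltnW (ltn_expl _ q1)) _; rewrite leq_exp2l.
Qed.

Local Notation T d := (ncard (twist_isoclasses R G d)).

Lemma twist_classes_pow d : T d != 0%N -> exists i, d = (q ^ i)%N.
Proof.
have q1 := residue_gt1; case: d => [|d]; first by rewrite twist_classes0 /ncard fset_set0.
have [] // := @twist_classes_level d.+1 d.+1.
  by apply: leq_trans (ltnW (ltn_expl _ q1)) _; rewrite leq_exp2l.
move=> _ ->; rewrite cards_eq0 => /set0Pn[s]; rewrite inE => /eqP.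
move=> /level_dimE[_ [i [_ _ dqi _ [ile _ _]]]].
exists (2 * d.+2 - i)%N; exact: expn_mul_cancel q1 ile dqi.
Qed.

(** Levels start at O / p, so the case e = 0 of the sum below is separate. At level 0, dimension 1
    forces i = 2, beyond the length 1 of the ring, so all coefficients are multiples of [pi = 0]. *)
Lemma twist_classes1 : T 1 = 1%N.
Proof.
have q1 := residue_gt1; have [] // := @twist_classes_level 0 1.
  by rewrite expn_gt0 ltnW.
move=> _ ->; apply/eqP/cards1P; exists (0, ((0, 0), (0, 0))).
apply/setP => s; rewrite !inE exp1n mul1n; apply/eqP/eqP => [|->]; last first.
  rewrite /zform_ker /=; transitivity #|{: level_quo 0 * level_quo 0 * level_quo 0 * level_quo 0}|.
    by rewrite -cardsT; apply: eq_card => -[[[a b] c] d]; rewrite !inE oppr0 !mul0r !addr0 eqxx.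
  by rewrite !card_prod; ring.
move=> sE; have : (1 ^ 2 * zform_ker s = #|level_quo 0| ^ 4)%N by rewrite exp1n mul1n.
move=> /level_dimE[pi [i [_ ch qi _ [_ _ ipi]]]].
have i2 : i = 2%N by apply/eqP; rewrite -(eqn_exp2l _ _ q1) -[X in X == _]mul1n qi.
have [_ [pi0 _] _ _] := ch; rewrite expr1 in pi0.
have := ipi; rewrite i2 pi0 => -[] // {ipi}.
case: s {sE} => a [[w x] [y z]] /= /dvdBP[? ->] /dvdBP[? ->] /dvdBP[? ->] /dvdBP[? ->] /dvdBP[? ->].
by rewrite !mul0r.
Qed.

(** For e = k + 1, a form at level [k] has dimension q^(2e - i): it is counted for exactly one j if
    e <= i, that is if its matrix is singular, and for none otherwise. The coefficient [s.1] is free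
    and contributes q^e. *)
Lemma twist_classes_sum e :
  (q * (\sum_(j < e.+1) T (q ^ j)) + q ^ (3 * e) = q ^ (4 * e).+1 + q ^ (4 * e))%N.
Proof.
have q1 := residue_gt1.
case: e => [|k].
  have -> : (\sum_(j < 1) T (q ^ j) = 1)%N by rewrite big_ord1; exact: twist_classes1.
  by rewrite !muln0 expn0 expn1 muln1.
have [pi [pip ch]] := quot_exp_chain p_neq0 k.
have -> : (\sum_(j < k.+2) T (q ^ j) =
    #|[set s : zform (level_quo k) | (s.2.1.1 * s.2.2.2 == s.2.1.2 * s.2.2.1)%R]%SET|)%N.
  transitivity (\sum_(j < k.+2) \sum_(s : zform (level_quo k))
    ((q ^ j) ^ 2 * zform_ker s == #|level_quo k| ^ 4))%N.
    apply: eq_bigr => j _; have [| |_ ->] := @twist_classes_level k (q ^ j).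
    - by rewrite expn_gt0 ltnW.
    - by rewrite leq_exp2l // -ltnS.
    - by rewrite -sum1_card big_mkcond; apply: eq_bigr => s _; rewrite inE; case: eqP.
  rewrite exchange_big /= -[RHS]sum1_card [RHS]big_mkcond; apply: eq_bigr => s _; rewrite inE.
  have [i [iK ile idet _]] := ker_card ch s.1 s.2.1.1 s.2.1.2 s.2.2.1 s.2.2.2.
  rewrite -[_ == _ * _]subr_eq0 -idet /zform_ker iK (chain_card ch).
  have jE (j : 'I_k.+2) : ((q ^ j) ^ 2 * (q ^ i) ^ 2 == (q ^ k.+1) ^ 4)%N = (j + i == 2 * k.+1)%N.
    by rewrite -expnMn -expnD -!expnM eqn_exp2l //; lia.
  rewrite (eq_bigr (fun j : 'I_k.+2 => nat_of_bool (j + i == 2 * k.+1)%N)); last by move=> j _; rewrite jE.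
  case: ifP => ki; last first.
    by rewrite big1 // => j _; have := ltn_ord j; case: eqP => //; lia.
  have lt : (2 * k.+1 - i < k.+2)%N by lia.
  rewrite (bigD1 (Ordinal lt)) //= subnK // eqxx big1 // => j /eqP nj.
  by case: eqP => // ji; case: nj; apply: val_inj => /=; lia.
have -> : #|[set s : zform (level_quo k) | (s.2.1.1 * s.2.2.2 == s.2.1.2 * s.2.2.1)%R]%SET| =
   (#|level_quo k| * #|[set s : (level_quo k * level_quo k) * (level_quo k * level_quo k) |
      (s.1.1 * s.2.2 == s.1.2 * s.2.1)%R]%SET|)%N.
  rewrite -cardsT -cardsX; apply: eq_card => s; rewrite !inE.
  by rewrite andTb.
have := card_det0 ch; rewrite (chain_card ch); move: #|_|%N => D DE.
transitivity (q ^ k.+1 * (q * D + q ^ (2 * k.+1)))%N.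
  have -> : (3 * k.+1 = k.+1 + 2 * k.+1)%N by lia.
  by rewrite mulnDr -expnD mulnCA.
have -> : ((4 * k.+1).+1 = k.+1 + (3 * k.+1).+1)%N by lia.
have -> : (4 * k.+1 = k.+1 + 3 * k.+1)%N by lia.
by rewrite DE mulnDr -!expnD.
Qed.
End ClassCount.

(** * Summation *)

(** [up_log q N] is the number of powers of [q] strictly below [N]. *)
Lemma sum_powers (C : comNzRingType) (T : nat -> nat) (a : nat -> C) q N : (1 < q)%N ->
  (forall d, T d != 0%N -> exists i, d = (q ^ i)%N) ->
  \sum_(1 <= k < N) (T k)%:R * a k = \sum_(j < up_log q N) (T (q ^ j)%N)%:R * a (q ^ j)%N.
Proof.
move=> q1 Tq; elim: N => [|[|N] IH]; first by rewrite up_log0 big_ord0 big_geq.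
  by rewrite up_log1 big_ord0 big_geq.
rewrite big_nat_recr //= IH; have [[j Nj]|nN] := EM (exists j, N.+1 = q ^ j)%N.
  have -> : up_log q N.+1 = j by rewrite Nj up_expnK.
  have -> : up_log q N.+2 = j.+1.
    by apply: up_log_eq => //; apply/andP; split; [rewrite -Nj | rewrite Nj ltn_exp2l].
  by rewrite big_ord_recr /= -Nj.
have -> : T N.+1 = 0%N by apply: contrapT => /eqP/Tq.
rewrite mul0r addr0; suff -> : up_log q N.+2 = up_log q N.+1 by [].
apply/eqP; rewrite eqn_leq; apply/andP; split; last exact: leq_up_log.
apply: up_log_min => //; rewrite ltn_neqAle up_logP // andbT.
by apply/eqP => NE; apply: nN; exists (up_log q N.+1).
Qed.

(** The coefficients come from Abel summation: with S_n = ((Q + 1) Q^(4n) - Q^(3n)) / Q, the sum is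
    S_n t^n plus (1 - t) times the sum of S_j t^j over j < n, and the two geometric series give the
    limit and the two tails. The induction only verifies the outcome. *)
Lemma partial_sum_closed (C : fieldType) (T : nat -> nat) (q : nat) (t : C) (Q := q%:R : C) :
  (forall e, (q * (\sum_(j < e.+1) T j) + q ^ (3 * e) = q ^ (4 * e).+1 + q ^ (4 * e))%N) ->
  Q != 0 -> 1 - Q ^+ 4 * t != 0 -> 1 - Q ^+ 3 * t != 0 -> forall n,
  \sum_(j < n.+1) (T j)%:R * t ^+ j =
    (1 - t) * (1 - Q ^+ 2 * t) / ((1 - Q ^+ 3 * t) * (1 - Q ^+ 4 * t)) +
    ((Q + 1) * (1 - (1 - t) / (1 - Q ^+ 4 * t)) / Q * (Q ^+ 4 * t) ^+ n +
     ((1 - t) / (1 - Q ^+ 3 * t) - 1) / Q * (Q ^+ 3 * t) ^+ n).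
Proof.
move=> TE Q0 u1 v1.
have TS e : Q * (\sum_(j < e.+1) (T j)%:R) = (Q + 1) * (Q ^+ 4) ^+ e - (Q ^+ 3) ^+ e.
  have := congr1 (fun n => n%:R : C) (TE e).
  rewrite !natrD natrM natr_sum !natrX -!exprM exprS => TEe.
  by apply: (addIr (Q ^+ (3 * e))); rewrite TEe; ring.
elim=> [|n IH].
  rewrite big_ord1 expr0 mulr1; have := TS 0%N; rewrite big_ord1 !expr0 => T0.
  have -> : (T 0%N)%:R = 1 :> C by apply: (mulfI Q0); rewrite T0; ring.
  by field; rewrite v1 u1 Q0.
rewrite big_ord_recr /= IH.
have Tn : (T n.+1)%:R = ((Q + 1) * (Q ^+ 4) ^+ n * (Q ^+ 4 - 1) - (Q ^+ 3) ^+ n * (Q ^+ 3 - 1)) / Q.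
  apply: (mulfI Q0); have := TS n.+1; rewrite big_ord_recr /= mulrDr TS => TSn.
  transitivity ((Q + 1) * (Q ^+ 4) ^+ n.+1 - (Q ^+ 3) ^+ n.+1 - ((Q + 1) * (Q ^+ 4) ^+ n - (Q ^+ 3) ^+ n)).
    by rewrite -TSn addrC addKr.
  by rewrite !(exprS _ n); field.
rewrite Tn !(exprS _ n) !exprMn; move: ((Q ^+ 4) ^+ n) ((Q ^+ 3) ^+ n) (t ^+ n) => a b c.
by field; rewrite v1 u1 Q0.
Qed.

(** * Complex powers and limits *)

Section ComplexAnalysis.
Variable R : realType.
Local Notation C := (Cplx R).

Lemma cnormX (z : C) n : cnorm (z ^+ n) = cnorm z ^+ n.
Proof.
elim: n => [|n IH]; last by rewrite !exprS cnormM IH.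
by apply: complexI; rewrite -cnormE normr1 rmorph1.
Qed.

Lemma cnorm_nat n : cnorm (n%:R : C) = n%:R.
Proof. by apply: complexI; rewrite -cnormE normr_nat rmorph_nat. Qed.

Lemma cvg_cexp (z : C) : cnorm z < 1 -> (fun n => z ^+ n) @ \oo --> (0 : C).
Proof.
move=> z1; apply/cvgr0Pnorm_lt => eps eps0.
have epsE : ((complex.Re eps)%:C)%C = eps by apply/RRe_real/gtr0_real.
have e0 : 0 < complex.Re eps by rewrite -ltcR epsE.
have : (fun n => cnorm z ^+ n) @ \oo --> (0 : R).
  by apply: cvg_expr; rewrite ger0_norm // cnorm_ge0.
move=> /cvgr0Pnorm_lt/(_ _ e0); apply: filterS => n.
by rewrite -epsE cnorm_lt cnormX ger0_norm // exprn_ge0 // cnorm_ge0.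
Qed.

Lemma cpowM (x y : R) (s : C) : 0 < x -> 0 < y -> cpow (x * y) s = cpow x s * cpow y s.
Proof.
move=> x0 y0; rewrite /cpow lnM ?posrE // !mulrDr expRD cosD sinD.
by apply/eqP; rewrite eq_complex /=; apply/andP; split; apply/eqP; ring.
Qed.

Lemma cpow1 (s : C) : cpow 1 s = 1.
Proof. by rewrite /cpow ln1 !mulr0 expR0 cos0 sin0 mulr1 mulr0. Qed.

Lemma cpowX (x : R) n (s : C) : 0 < x -> cpow (x ^+ n) s = cpow x s ^+ n.
Proof.
move=> x0; elim: n => [|n IH]; first by rewrite !expr0 cpow1.
by rewrite !exprS cpowM ?exprn_gt0 // IH.
Qed.

Lemma cnorm_cpow (x : R) (s : C) : cnorm (cpow x s) = expR (complex.Re s * ln x).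
Proof.
by rewrite /cnorm normc_def /= !exprMn -mulrDr cos2Dsin2 mulr1 sqrtr_sqr ger0_norm //.
Qed.
End ComplexAnalysis.

Section ZetaLimit.
Variables (R : realType) (K : fieldExtType rat) (p : prime_idealr (ring_of_integers K)).
Hypothesis p_neq0 : exists2 x : ring_of_integers K, x \in p & x != 0.
Local Notation C := (Cplx R).
Local Notation G := (Qgroup 1 1 (completion p)).
Local Notation q := (ncard [set: {ideal_quot p}]).

Lemma zeta_partial_powers (s : C) N :
  zeta_partial G s N =
  \sum_(j < up_log q N) (ncard (twist_isoclasses R G (q ^ j)%N))%:R * cpow q%:R (- s) ^+ j.
Proof.
have q1 := residue_gt1 p_neq0.
rewrite /zeta_partial (@sum_powers C (fun d => ncard (twist_isoclasses R G d))
  (fun k => cpow k%:R (- s)) _ N q1 (@twist_classes_pow R K p p_neq0)).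
by apply: eq_bigr => j _; rewrite natrX cpowX // ltr0n ltnW.
Qed.

Lemma cvg_up_log a : (1 < a)%N -> up_log a n @[n --> \oo] --> \oo.
Proof.
move=> a1; apply/cvgnyPge => M; exists (a ^ M)%N => // n /= Mn.
by rewrite -(up_expnK M a1); apply: leq_up_log.
Qed.

Lemma cvg_zeta (s : C) (Q := q%:R : C) (t := cpow q%:R (- s) : C) : 4 < complex.Re s ->
  zeta_partial G s @ \oo -->
    (1 - t) * (1 - Q ^+ 2 * t) / ((1 - Q ^+ 3 * t) * (1 - Q ^+ 4 * t)).
Proof.
move=> s4; have q1 := residue_gt1 p_neq0.
have lnq : 0 < ln (q%:R : R) by rewrite ln_gt0 // ltr1n.
have q0 : 0 < (q%:R : R) by rewrite ltr0n ltnW.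
have Q0 : Q != 0 by rewrite pnatr_eq0 -lt0n ltnW.
(* The norm of t is q^(- Re s), so Re s > 4 brings both ratios q^3 t and q^4 t below 1. *)
have small k : (k <= 4)%N -> cnorm (Q ^+ k * t) < 1.
  move=> k4; rewrite cnormM cnormX cnorm_nat cnorm_cpow.
  have -> : q%:R ^+ k = expR (k%:R * ln (q%:R : R)) by rewrite expRM_natl lnK.
  rewrite -expRD -mulrDl expR_lt1 pmulr_llt0 //.
  have : (k%:R : R) <= 4 by rewrite (ler_nat _ k 4).
  by case: (s) s4 => a b /=; lra.
have ne1 (z : C) : cnorm z < 1 -> 1 - z != 0.
  apply: contraTneq => /eqP; rewrite subr_eq0 => /eqP <-.
  by rewrite (cnorm_nat R 1 : cnorm (1 : C) = 1) ltxx.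
have closed := @partial_sum_closed C (fun j => ncard (twist_isoclasses R G (q ^ j)%N)) q t
  (@twist_classes_sum R K p p_neq0) Q0
  (ne1 _ (small 4 isT)) (ne1 _ (small 3 isT)).
pose S n := \sum_(j < n) (ncard (twist_isoclasses R G (q ^ j)%N))%:R * t ^+ j.
have lim (l a b : C) : (fun n => l + (a * (Q ^+ 4 * t) ^+ n + b * (Q ^+ 3 * t) ^+ n)) @ \oo --> l.
  have : (fun n => l + (a * (Q ^+ 4 * t) ^+ n + b * (Q ^+ 3 * t) ^+ n)) @ \oo -->
      l + (a * 0 + b * 0).
    apply: cvgD; first exact: cvg_cst.
    by apply: cvgD; apply: cvgM; [exact: cvg_cst | apply/cvg_cexp/small
      | exact: cvg_cst | apply/cvg_cexp/small].
  by rewrite !mulr0 !addr0.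
have SL : S @ \oo --> (1 - t) * (1 - Q ^+ 2 * t) / ((1 - Q ^+ 3 * t) * (1 - Q ^+ 4 * t)).
  rewrite -cvg_shiftS; have -> : [sequence S n.+1]_n = _ := funext closed.
  exact: lim.
(* The partial sums of the Dirichlet series are those of the power series in t, repeated between
   consecutive powers of q. *)
have -> : zeta_partial G s = S \o up_log q.
  by apply: funext => N; rewrite zeta_partial_powers.
exact: cvg_comp (cvg_up_log q1) SL.
Qed.
End ZetaLimit.

Theorem theorem1p1 (R : realType) (K : fieldExtType rat)
    (p : prime_idealr (ring_of_integers K))
    (p_neq0 : exists2 x : ring_of_integers K, x \in p & x != 0) :
  let G : preTopologicalGroupType := Qgroup 1 1 (completion p) in
  let q := ncard [set: {ideal_quot p}] in
  (forall k : nat, finite_set (twist_isoclasses R G k)) /\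
  exists sigma0 : R, forall s : Cplx R, sigma0 < complex.Re s ->
    let t := cpow q%:R (- s) in
    cvgn (zeta_partial G s) /\
    zeta G s =
      (1 - t) * (1 - q%:R ^+ 2 * t) / ((1 - q%:R ^+ 3 * t) * (1 - q%:R ^+ 4 * t)).
Proof.
move=> G q; split; first exact: twist_classes_finite.
exists 4 => s s4 t; have zL := cvg_zeta p_neq0 s4.
split; first by apply/cvg_ex; eexists; exact: zL.
exact: cvg_lim zL.
Qed.
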